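(* Let $\alpha,\beta\in\mathbb{R}\setminus\mathbb{Q}$, and let $h:\mathbb{R}\to\mathbb{R}$ be a $1$-periodic function which is $C^{1+\varepsilon}$-smooth for some $\varepsilon>0$. Let $T:\mathbb{T}^\omega\to\mathbb{T}^\omega$ be the map $$T:(x_1,x_2,\ldots,x_k,\ldots)\mapsto (x_1+\alpha,\ x_2+h(x_1),\ \ldots,\ x_k+h(x_1+(k-2)\beta),\ \ldots),$$ that is, the first coordinate of $T(x)$ is $x_1+\alpha$ and, for every $k\geqslant 2$, the $k$-th coordinate of $T(x)$ is $x_k+h(x_1+(k-2)\beta)$ (all modulo $1$). Then the system $(\mathbb{T}^\omega,T,\nu)$ has a polynomial rate of rigidity for every $\nu\in M(\mathbb{T}^\omega,T)$.
   Context: $\mathbb{T}=\mathbb{R}/\mathbb{Z}$, and $\mathbb{T}^\omega=\prod_{\mathbb{N}}\mathbb{T}$ is the infinite-dimensional torus: the product of countably many copies of $\mathbb{T}$ (indexed by the positive integers), with the product topology. $C^{1+\varepsilon}$-smooth is the usual Hölder smoothness: for $0<\varepsilon<1$, it means that $h$ is continuously differentiable and $h'$ is Hölder continuous with exponent $\varepsilon$. For a compact space $X$ and a homeomorphism $T:X\to X$, $M(X,T)$ denotes the set of all $T$-invariant Borel probability measures on $X$, and $C(X)$ the space of continuous functions on $X$. A subset $\mathcal{F}\subseteq C(X)$ is linearly dense if the set of linear combinations of elements of $\mathcal{F}$ is dense in $C(X)$. Polynomial rate of rigidity: for $\nu\in M(X,T)$, the system $(X,T,\nu)$ has a polynomial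 rate of rigidity if there exists a linearly dense subset $\mathcal{F}\subseteq C(X)$ such that for every $f\in\mathcal{F}$ there are $\delta>0$ and a strictly increasing sequence $\{r_n\}_{n\geqslant1}$ of positive integers such that $$\sum_{|j|\leqslant r_n^{\delta}}\|f\circ T^{jr_n}-f\|_{L^2(\nu)}^2\to 0\quad\text{as } n\to\infty,$$ where $j$ ranges over the integers with $|j|\leqslant r_n^\delta$. *)

(* Defs.v *)
From HB Require Import structures.
From mathcomp Require Import all_boot all_order all_algebra.
From mathcomp Require Import all_classical all_reals all_analysis.
From mathcomp Require Import complex.

Set Implicit Arguments.
Unset Strict Implicit.
Unset Printing Implicit Defensive.

Import Order.TTheory GRing.Theory Num.Theory.
Import numFieldNormedType.Exports.

Local Open Scope classical_set_scope.
Local Open Scope ring_scope.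
Local Open Scope quotient_scope.

Record homeo (X : topologicalType) := Homeo {
  homeo_fun :> X -> X ;
  homeo_inv : X -> X ;
  homeo_funK : cancel homeo_fun homeo_inv ;
  homeo_invK : cancel homeo_inv homeo_fun ;
  homeo_fun_continuous : continuous homeo_fun ;
  homeo_inv_continuous : continuous homeo_inv }.

Definition homeo_iter (X : topologicalType) (T : homeo X) (n : int) : X -> X :=
  match n with
  | Posz m => iter m T
  | Negz m => iter m.+1 (homeo_inv T)
  end.

Notation borel X := (g_sigma_algebraType (@open X)).

Definition invariant_probability (R : realType) (X : ptopologicalType)
    (T : homeo X) : set (probability (borel X) R) :=
  [set nu | forall A : set (borel X), measurable A -> nu (T @^-1` A) = nu A].

Definition linear_span (K : numFieldType) (X : Type) (F : set (X -> K)) :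
    set (X -> K) :=
  [set g | exists n (c : 'I_n -> K) (f : 'I_n -> X -> K),
    (forall i, F (f i)) /\ forall x, g x = \sum_(i < n) c i * f i x].

(* density in C(X) for the topology of uniform convergence *)
Definition linearly_dense (K : numFieldType) (X : topologicalType)
    (F : set (X -> K)) :=
  [set g : X -> K | continuous g] `<=`
    closure (linear_span F : set {uniform X -> K}).

(* [normc z : R] is the modulus of [z : R[i]], while [`|z|] lives in [R[i]] *)
Definition L2_norm (R : realType) (X : ptopologicalType)
    (nu : probability (borel X) R) (g : X -> R[i]) : \bar R :=
  ('N[nu]_2%:E[(fun x => (ComplexField.Normc.normc (g x))%:E)])%E.

Definition rigidity_sum (R : realType) (X : ptopologicalType) (T : homeo X)
    (nu : probability (borel X) R) (f : X -> R[i]) (delta : R) (r : nat) :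
    \bar R :=
  (\sum_(j \in [set j : int | (`|j|%:~R <= r%:R `^ delta :> R)%R])
     L2_norm nu (fun x => f (homeo_iter T (j * r%:Z)%R x) - f x)%R ^+ 2)%E.

Definition polynomial_rigidity (R : realType) (X : ptopologicalType)
    (T : homeo X) (nu : probability (borel X) R) : Prop :=
  exists F : set (X -> (R[i] : numFieldType)),
    [/\ (forall f, F f -> continuous f),
        linearly_dense F &
        forall f, F f -> exists delta : R, 0 < delta /\
          exists r : nat -> nat,
            [/\ (forall n, (0 < r n)%N), increasing_seq r &
              rigidity_sum T nu f delta (r n) @[n --> \oo] --> 0%E]].

Section Circle.
Variable R : realType.

Definition int_subgroup : zmodClosed R :=
  GRing.ZmodClosed.clone R (@Num.int_num_subdef R) _.

Definition circle : Type :=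
  quotient_topology (ring_quotient.Quotient.quot int_subgroup).

HB.instance Definition _ := PointedTopological.on circle.
HB.instance Definition _ := Quotient.on circle.
HB.instance Definition _ := GRing.isZmodule.Build circle
  (@ring_quotient.Quotient.addqA R int_subgroup)
  (@ring_quotient.Quotient.addqC R int_subgroup)
  (@ring_quotient.Quotient.add0q R int_subgroup)
  (@ring_quotient.Quotient.addNq R int_subgroup).

Definition to_circle (t : R) : circle := \pi_circle t.

Lemma to_circleP (s t : R) :
  to_circle s = to_circle t <-> s - t \is a Num.int.
Proof.
have e := @ring_quotient.Quotient.idealrBE R int_subgroup s t.
split=> [st|]; first by rewrite -[_ \is a _]/(_ \in _) e; apply/eqP.
by rewrite -[_ \is a _]/(_ \in _) e => /eqP.
Qed.

Lemma to_circleD (s t : R) : to_circle (s + t) = to_circle s + to_circle t.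
Proof. exact: (@ring_quotient.Quotient.pi_add R int_subgroup). Qed.

Lemma to_circle0 : to_circle 0 = 0.
Proof. by apply: (addrI (to_circle 0)); rewrite -to_circleD !addr0. Qed.

Lemma to_circleN (t : R) : to_circle (- t) = - to_circle t.
Proof.
by apply: (addrI (to_circle t)); rewrite -to_circleD !subrr to_circle0.
Qed.

Lemma to_circle_continuous : continuous to_circle.
Proof. exact: pi_continuous. Qed.

Lemma repr_to_circle (t : R) : exists m : int, repr (to_circle t) = t + m%:~R.
Proof.
have /to_circleP/intrP[m em] : to_circle (repr (to_circle t)) = to_circle t.
  by rewrite /to_circle reprK.
exists m.
by rewrite -em addrC subrK.
Qed.

Lemma to_circle_open (A : set R) : open A -> open (to_circle @` A).
Proof.
move=> oA; rewrite /open /= /quotient_open.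
rewrite (_ : _ @^-1` _ = \bigcup_(m : int) ((fun t => t + m%:~R) @^-1` A)).
  apply: bigcup_open => m _; apply: open_comp => // t _.
  by apply: cvgD; [exact: cvg_id|exact: cvg_cst].
apply/seteqP; split=> [t /= [s As] /to_circleP/intrP[m sm]|t [m _ /= Atm]].
  by exists m => //=; rewrite -sm addrC subrK.
exists (t + m%:~R) => //; apply/to_circleP.
by rewrite addrAC subrr add0r intr_int.
Qed.

Lemma circle_add_continuous (Z : topologicalType) (f g : Z -> circle) :
  continuous f -> continuous g -> continuous (fun z => f z + g z).
Proof.
move=> cf cg z W.
rewrite nbhsE => -[/= V [oV Vz] VW].
have reprE (c : circle) : to_circle (repr c) = c by rewrite /to_circle reprK.
have : nbhs (repr (f z) + repr (g z)) (to_circle @^-1` V).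
  apply: to_circle_continuous; apply: open_nbhs_nbhs; split=> //.
  by rewrite to_circleD !reprE.
move=> /nbhs_ballP[e /= e0 eV].
have ball_nbhs (c : circle) : nbhs c (to_circle @` ball (repr c) (e / 2)).
  apply: open_nbhs_nbhs; split.
    by apply: to_circle_open; exact: ball_open.
  by exists (repr c) => //; apply: ballxx; rewrite divr_gt0.
have Hf := cf z _ (ball_nbhs (f z)); have Hg := cg z _ (ball_nbhs (g z)).
have := @filterI _ (nbhs z) (nbhs_filter z) _ _ Hf Hg.
apply: (@filterS _ (nbhs z)) => y [] /= [s sf fy] [t tg gy]; apply: VW.
rewrite /= -fy -gy -to_circleD; apply: eV; rewrite /ball /= opprD addrACA.
rewrite (le_lt_trans (ler_normD _ _))// [e]splitr ltrD//.
Qed.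

Definition torus : Type := prod_topology (fun _ : nat => circle).

HB.instance Definition _ := Topological.copy torus
  (prod_topology (fun _ : nat => circle)).
HB.instance Definition _ := isPointed.Build torus (fun _ => point).

Lemma torus_continuous (Z : topologicalType) (f : Z -> torus) :
  (forall k, continuous (fun z => f z k)) -> continuous f.
Proof.
move=> cf z; apply/cvg_sup => k U /= [B [[V oV <-] /= Vz] VU].
apply: filterS VU _; apply: (cf k z); exact: open_nbhs_nbhs.
Qed.

Lemma torus_proj_continuous (k : nat) : continuous (fun x : torus => x k).
Proof. exact: (@proj_continuous _ (fun _ : nat => circle) k). Qed.

Lemma torus_compact : compact [set: torus].
Proof.
have cT : compact [set: circle].
  rewrite (_ : setT = to_circle @` `[0, 1]).
    apply: continuous_compact; last exact: segment_compact.
    by apply: continuous_subspaceT => x; exact: to_circle_continuous.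
  apply/esym; rewrite -subTset => c _ /=.
  exists (repr c - (Num.floor (repr c))%:~R).
    by rewrite in_itv /= subr_ge0 ge_floor /= lerBlDl -intrD1 ltW // floorD1_gt.
  rewrite -[RHS](reprK (c : ring_quotient.Quotient.quot int_subgroup)).
  by apply/to_circleP; rewrite addrAC subrr sub0r rpredN intr_int.
have := @tychonoff nat (fun=> circle) (fun=> setT) (fun=> cT).
congr (compact _); first by rewrite -subTset.
Qed.

End Circle.

Section SkewProduct.
Variables (R : realType) (alpha beta : R) (h : R -> R).

(* [h (c + k beta)] for [c] in [R/Z]; independent of the representative of [c]
   when [h] is 1-periodic *)
Definition cocycle (k : nat) (c : circle R) : circle R :=
  to_circle (h (repr c + k%:R * beta)).

(* [x k] is the coordinate usually numbered [k + 1] *)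
Definition skew (x : torus R) : torus R := fun k =>
  match k with
  | 0 => x 0%N + to_circle alpha
  | k'.+1 => x k + cocycle k' (x 0%N)
  end.

Definition skew_inv (x : torus R) : torus R := fun k =>
  match k with
  | 0 => x 0%N + to_circle (- alpha)
  | k'.+1 => x k - cocycle k' (x 0%N + to_circle (- alpha))
  end.

Lemma skewK : cancel skew skew_inv.
Proof.
move=> x; apply/funext => -[|k] /=; rewrite to_circleN addrK //.
by rewrite addrK.
Qed.

Lemma skew_invK : cancel skew_inv skew.
Proof.
by move=> x; apply/funext => -[|k] /=; rewrite to_circleN subrK.
Qed.

Hypothesis h_periodic : forall t, h (t + 1) = h t.
Hypothesis h_continuous : continuous h.

Lemma h_periodic_int (m : int) (t : R) : h (t + m%:~R) = h t.
Proof.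
have hn (n : nat) s : h (s + n%:R) = h s.
  elim: n => [|n IH]; first by rewrite addr0.
  by rewrite -addn1 natrD addrA h_periodic.
case: m => n; first exact: hn.
by rewrite NegzE mulrNz -[in RHS](subrK (n.+1%:R) t) hn.
Qed.

Lemma cocycle_to_circle (k : nat) (t : R) :
  cocycle k (to_circle t) = to_circle (h (t + k%:R * beta)).
Proof.
rewrite /cocycle; have [m ->] := repr_to_circle t.
by rewrite addrAC h_periodic_int.
Qed.

Lemma cocycle_continuous (k : nat) : continuous (cocycle k).
Proof.
apply/quotient_continuous.
rewrite (_ : _ \o _ = to_circle (R:=R) \o (h \o (fun t => t + k%:R * beta))).
  move=> t; apply: continuous_comp; last exact: to_circle_continuous.
  apply: continuous_comp; last exact: h_continuous.
  by apply: cvgD; [exact: cvg_id|exact: cvg_cst].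
by apply/funext => t /=; exact: cocycle_to_circle.
Qed.

Lemma skew_continuous : continuous skew.
Proof.
apply: torus_continuous => -[|k] /=.
  apply: circle_add_continuous; first exact: torus_proj_continuous.
  exact: cst_continuous.
apply: circle_add_continuous; first exact: torus_proj_continuous.
move=> x; apply: continuous_comp; first exact: torus_proj_continuous.
exact: cocycle_continuous.
Qed.

Lemma circle_opp_continuous : continuous (fun c : circle R => - c).
Proof.
apply/quotient_continuous.
rewrite (_ : _ \o _ = to_circle (R:=R) \o -%R).
  move=> t; apply: continuous_comp; last exact: to_circle_continuous.
  exact: opp_continuous.
by apply/funext => t /=; rewrite to_circleN.
Qed.

Lemma skew_inv_continuous : continuous skew_inv.
Proof.
have c0 : continuous (fun x : torus R => x 0%N + to_circle (- alpha)).
  apply: circle_add_continuous; first exact: torus_proj_continuous.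
  exact: cst_continuous.
apply: torus_continuous => -[|k] //=.
apply: circle_add_continuous; first exact: torus_proj_continuous.
have cc := @cocycle_continuous k.
have : continuous ((fun c : circle R => - c) \o (cocycle k \o
    (fun x : torus R => x 0%N + to_circle (- alpha)))).
  move=> x; apply: continuous_comp; last exact: circle_opp_continuous.
  by apply: continuous_comp; [exact: c0|exact: cc].
exact.
Qed.

Definition skew_homeo : homeo (torus R) :=
  Homeo skewK skew_invK skew_continuous skew_inv_continuous.

End SkewProduct.

Definition C1_holder (R : realType) (eps : R) (h : R -> R) : Prop :=
  [/\ forall x, derivable h x 1, continuous (derive1 h) &
      exists C : R, forall x y,
        `|derive1 h x - derive1 h y| <= C * `|x - y| `^ eps].

Lemma C1_holder_continuous (R : realType) (eps : R) (h : R -> R) :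
  C1_holder eps h -> continuous h.
Proof.
by move=> [dh _ _] x; apply/differentiable_continuous/derivable1_diffP.
Qed.

(* Main.v *)
(** Every estimate is uniform in the point, so the measure plays no role.  The
characters of the torus belong to the set [cocycle_character] of continuous
unimodular [f] with [f \o T = f * exp(2 pi i u(x_0))] for a 1-periodic [u] of
class C^{1+eps}.  This set is a multiplicative monoid spanning a dense algebra,
so it suffices to find [r] with the Birkhoff sum [S_r u] over the rotation by
[alpha] within [r^(-gamma)] of an integer, uniformly in the point.

If [|q alpha - p| <= 1/q] with [p], [q] coprime, then [S_q u'] is
[O(q^(1-eps))], by comparison with an equispaced sum.  The oscillation of
[S_q u] is controlled along the orbit by the identity
[S_q u (x + i alpha) - S_q u x = S_i u (x + q alpha) - S_i u x].  When
[|q alpha - p| <= q^(-2)] for infinitely many [q] the trivial bound on [S_i u']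
suffices; otherwise [alpha] is Diophantine and [S_i u'] itself has a power
saving.  Either way [S_q u] is within [O(q^(-eps/4))] of a constant [theta] for
infinitely many [q], and Dirichlet's theorem applied to [theta] gives
[r = k q]. *)

Require Import Defs.
From mathcomp Require Import all_boot all_order all_algebra.
From mathcomp Require Import all_classical all_reals all_analysis.
From mathcomp Require Import complex.
From mathcomp Require Import ring lra zify.

Import Order.TTheory GRing.Theory Num.Theory.
Import numFieldNormedType.Exports.

Local Open Scope classical_set_scope.
Local Open Scope complex_scope.
Local Open Scope ring_scope.

(** * Diophantine approximation *)

(** Pigeonhole: the [Q + 1] fractional parts of [j a], [0 <= j <= Q], fall into [Q] boxes of length
    [1/Q], so two of them share a box. *)
Lemma dirichlet (R : realType) (a : R) (Q : nat) : (0 < Q)%N ->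
  exists (q : nat) (p : int),
    [/\ (0 < q)%N, (q <= Q)%N & `|q%:R * a - p%:~R| <= Q%:R^-1].
Proof.
case: Q => // Q' _; set Q := Q'.+1.
have Q0 : 0 < Q%:R :> R by rewrite ltr0n.
pose fr (j : nat) : R := j%:R * a - (Num.floor (j%:R * a))%:~R.
have fr0 j : 0 <= fr j by rewrite subr_ge0 ge_floor.
have fr1 j : fr j < 1 by rewrite ltrBlDl -intrD1 floorD1_gt.
pose box (j : 'I_Q.+1) : 'I_Q := inord (Num.truncn (Q%:R * fr j)).
have boxE j : box j = Num.truncn (Q%:R * fr j) :> nat.
  rewrite inordK // truncn_lt_nat; last by rewrite mulr_ge0.
  by rewrite -[X in _ < X]mulr1 ltr_pM2l.
have /injectivePn[i [j ij bij]] : ~~ injectiveb box.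
  apply/negP => /injectiveP inj.
  have := leq_card _ inj; rewrite !card_ord; lia.
wlog ltij : i j ij bij / (i < j)%N.
  move=> W; case: (ltngtP i j) => [|h|/val_inj e]; first exact: W.
    by apply: (W j i) => //; rewrite eq_sym.
  by rewrite e eqxx in ij.
have close : `|fr j - fr i| <= Q%:R^-1.
  have bi := truncn_itv (mulr_ge0 (ltW Q0) (fr0 i)).
  have bj := truncn_itv (mulr_ge0 (ltW Q0) (fr0 j)).
  rewrite -!boxE -bij in bi bj; case/andP: bi => bi1 bi2; case/andP: bj => bj1 bj2.
  rewrite -(ler_pM2l Q0) divff ?gt_eqF// -[X in X * _](gtr0_norm Q0) -normrM.
  move: bi1 bj1 bi2 bj2; rewrite -[(box i).+1%:R]natr1 ler_norml (mulrBr Q%:R (fr j)).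
  move: (Q%:R * fr i) (Q%:R * fr j) ((box i)%:R : R) => s t b *.
  by apply/andP; split; lra.
exists (j - i)%N, (Num.floor (j%:R * a) - Num.floor (i%:R * a)); split.
- by rewrite subn_gt0.
- by have := ltn_ord j; lia.
rewrite natrB ?(ltnW ltij)// rmorphB /=.
by rewrite (_ : _ - _ = fr j - fr i)// /fr; ring.
Qed.

(** Dividing [q] and [p] by their gcd divides [|q a - p|] by it as well. *)
Lemma dirichlet_coprime (R : realType) (a : R) (Q : nat) : (0 < Q)%N ->
  exists (q : nat) (p : int),
    [/\ (0 < q)%N, (q <= Q)%N, coprimez p q & `|q%:R * a - p%:~R| <= Q%:R^-1].
Proof.
move=> Q0; have [q [p [q0 qQ qa]]] := dirichlet R a Q Q0.
pose d := gcdn q `|p|; have d0 : (0 < d)%N by rewrite gcdn_gt0 q0.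
have dq : (d %| q)%N by exact: dvdn_gcdl.
have dp : (d %| p)%Z by rewrite /dvdz /=; exact: dvdn_gcdr.
have [q' eq] := dvdnP dq; have [p' ep] := dvdzP dp.
have q'0 : (0 < q')%N by move: q0; rewrite eq muln_gt0 => /andP[].
exists q', p'; split=> //.
- by apply: leq_trans qQ; rewrite eq leq_pmulr.
- rewrite /coprimez /gcdz absz_nat; apply/eqP; congr Posz; apply/eqP.
  have e : `|p|%N = (`|p'| * d)%N by rewrite ep abszM.
  by rewrite -(eqn_pmul2r d0) mul1n muln_gcdl -e -eq gcdnC.
clearbody d; apply: le_trans qa; rewrite eq ep natrM rmorphM /=.
rewrite [X in _ <= `|X|](_ : _ = d%:R * (q'%:R * a - p'%:~R)); last by ring.
by rewrite normrM normr_nat ler_peMl// ler1n.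
Qed.

Lemma irrational_dist_int (R : realType) (a : R) : irrational a ->
  forall N : nat, exists2 c : R, 0 < c &
    forall (q : nat) (p : int), (0 < q < N)%N -> c <= `|q%:R * a - p%:~R|.
Proof.
move=> ira; elim=> [|N [c c0 IH]]; first by exists 1 => // q p; lia.
case: N IH => [|N] IH; first by exists 1 => // q p; lia.
(* For the new denominator [N.+1], the fractional part [f] is nonzero by irrationality, and every
   integer is at distance at least [min f (1 - f)] from [b]. *)
pose b := N.+1%:R * a; pose f := b - (Num.floor b)%:~R.
have f0 : 0 < f.
  rewrite lt_neqAle subr_ge0 ge_floor andbT eq_sym; apply/eqP => fE.
  apply: ira; apply/rationalP; exists (Num.floor b), N.+1.
  by move/subr0_eq: fE => <-; rewrite /b mulrAC divff ?mul1r// pnatr_eq0.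
have f1 : f < 1 by rewrite ltrBlDl -intrD1 floorD1_gt.
exists (Num.min c (Num.min f (1 - f))).
  by rewrite !lt_min c0 f0 subr_gt0.
move=> q p /andP[q0]; rewrite ltnS leq_eqVlt => /orP[/eqP ->|qN]; last first.
  by rewrite ge_min IH// q0.
rewrite -/b !ge_min; apply/orP; right.
have -> : b - p%:~R = f + (Num.floor b - p)%:~R by rewrite /f rmorphB /=; ring.
have [h|h] := lerP 0 (Num.floor b - p); apply/orP; [left|right].
  by apply: le_trans (ler_norm _); rewrite lerDl ler0z.
have h' : (Num.floor b - p)%:~R <= -1 :> R.
  by rewrite -[-1]/((-1)%:~R) ler_int; lia.
by have := ler_norm (- (f + (Num.floor b - p)%:~R)); rewrite normrN; lra.
Qed.

(** Denominators below [N] keep [|q a - p|] above a positive constant [c], so they are excluded as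
    soon as [1/Q < c]. *)
Lemma dirichlet_large (R : realType) (a : R) : irrational a ->
  forall N : nat, exists Q0 : nat, forall Q : nat, (Q0 <= Q)%N -> (0 < Q)%N ->
  exists (q : nat) (p : int),
    [/\ (N <= q <= Q)%N, coprimez p q & `|q%:R * a - p%:~R| <= Q%:R^-1].
Proof.
move=> ira N; have [c c0 Hc] := irrational_dist_int R a ira N.
exists (Num.truncn c^-1).+1 => Q Q0Q Q0.
have [q [p [q0 qQ cpq qa]]] := dirichlet_coprime R a Q Q0.
exists q, p; split=> //; rewrite qQ andbT leqNgt; apply/negP => qN.
have := le_trans (Hc q p _) qa; rewrite q0 qN => /(_ isT); apply/negP.
rewrite -ltNge -[X in _ < X]invrK ltf_pV2 ?posrE ?invr_gt0 ?ltr0n//.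
apply: lt_le_trans (truncnS_gt _) _; by rewrite ler_nat.
Qed.

(** * Birkhoff sums over a rotation *)

Definition birkhoff (R : realType) (alpha : R) (u : R -> R) (n : nat) (x : R) : R :=
  \sum_(i < n) u (x + i%:R * alpha).

Lemma is_derive_translate (R : realType) (f : R -> R) (c x df : R) :
  is_derive (x + c) 1 f df -> is_derive x 1 (fun t => f (t + c)) df.
Proof.
move=> fc; rewrite -[df]mulr1.
have sc : is_derive x 1 (fun t : R => t + c) 1.
  by rewrite -[X in is_derive _ _ _ X]addr0; apply: is_deriveD.
exact: (@is_derive1_comp _ f (fun t => t + c)).
Qed.

Lemma is_derive_birkhoff (R : realType) (alpha : R) (u v : R -> R) (n : nat) :
  (forall x : R, is_derive x 1 u (v x)) ->
  forall x : R, is_derive x 1 (birkhoff R alpha u n) (birkhoff R alpha v n x).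
Proof.
move=> uv x; rewrite /birkhoff.
have -> : (fun y => \sum_(i < n) u (y + i%:R * alpha)) =
    \sum_(i < n) (fun y => u (y + i%:R * alpha)).
  by apply/funext => y; rewrite fct_sumE.
by apply: is_derive_sum => i; apply: is_derive_translate.
Qed.

Lemma is_derive_lipschitz (R : realType) (f df : R -> R) (B : R) :
  (forall x : R, is_derive x 1 f (df x)) -> (forall x, `|df x| <= B) ->
  forall x y, `|f x - f y| <= B * `|x - y|.
Proof.
move=> fdf dfB x y; wlog xy : x y / y <= x.
  move=> W; have [/W//|/ltW/W] := leP y x.
  by rewrite distrC [`|y - x|]distrC.
have fC : {within `[y, x], continuous f}.
  by apply: continuous_subspaceT => z; apply/differentiable_continuous/derivable1_diffP.
have [c _ ->] := @MVT_segment R f df y x xy (fun z _ => fdf z) fC.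
by rewrite normrM ler_wpM2r.
Qed.

Lemma periodic_int (R : realType) (u : R -> R) : (forall t, u (t + 1) = u t) ->
  forall (m : int) t, u (t + m%:~R) = u t.
Proof. by move=> pu m t; apply: h_periodic_int. Qed.

Lemma birkhoff_int (R : realType) (alpha : R) (u : R -> R) (n : nat) :
  (forall t, u (t + 1) = u t) ->
  forall (m : int) t, birkhoff R alpha u n (t + m%:~R) = birkhoff R alpha u n t.
Proof.
by move=> pu m t; apply: eq_bigr => i _; rewrite addrAC periodic_int.
Qed.

Lemma birkhoffD (R : realType) (alpha : R) (u : R -> R) (m n : nat) (x : R) :
  birkhoff R alpha u (m + n) x =
  birkhoff R alpha u m x + birkhoff R alpha u n (x + m%:R * alpha).
Proof.
rewrite /birkhoff big_split_ord /=; congr (_ + _).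
by apply: eq_bigr => i _; rewrite natrD; congr u; ring.
Qed.

Lemma birkhoffM (R : realType) (alpha : R) (u : R -> R) (k q : nat) (x : R) :
  birkhoff R alpha u (k * q) x =
  \sum_(j < k) birkhoff R alpha u q (x + (j * q)%:R * alpha).
Proof.
elim: k => [|k IH]; first by rewrite mul0n /birkhoff !big_ord0.
by rewrite mulSnr birkhoffD IH big_ord_recr.
Qed.

(** The two ways of cutting a sum of length [i + q] agree. *)
Lemma birkhoff_coboundary (R : realType) (alpha : R) (u : R -> R) (i q : nat) (x : R) :
  birkhoff R alpha u q (x + i%:R * alpha) - birkhoff R alpha u q x =
  birkhoff R alpha u i (x + q%:R * alpha) - birkhoff R alpha u i x.
Proof.
have := birkhoffD R alpha u i q x; rewrite addnC birkhoffD => e.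
lra.
Qed.

(** As [p] is invertible modulo [q], the map [i -> i p mod q] permutes the residues, and [u] ignores
    the integer quotients. *)
Lemma periodic_residue_sum (R : realType) (u : R -> R) (q : nat) (p : int) (x : R) :
  (forall t, u (t + 1) = u t) -> (0 < q)%N -> coprimez p q ->
  \sum_(i < q) u (x + i%:R * (p%:~R / q%:R)) = \sum_(j < q) u (x + j%:R / q%:R).
Proof.
case: q => // q pu _ cpq.
pose s (i : 'I_q.+1) : 'I_q.+1 := inord `|((i : int) * p %% q.+1)%Z|.
have sE i : (s i : int) = ((i : int) * p %% q.+1)%Z.
  rewrite inordK; first by rewrite gez0_abs// modz_ge0.
  by rewrite -ltz_nat gez0_abs ?modz_ge0// ltz_pmod.
have s_inj : injective s.
  move=> i j /(congr1 (fun k : 'I_q.+1 => (k : int))); rewrite !sE => /eqP.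
  rewrite eqz_mod_dvd -mulrBl Gauss_dvdzl; last by rewrite coprimez_sym.
  rewrite -eqz_mod_dvd !modz_small; last 2 first.
    1,2: by rewrite /= ltz_nat ltn_ord.
  by move=> /eqP [] /val_inj.
rewrite [RHS](reindex_inj s_inj); apply: eq_bigr => i _.
rewrite -(periodic_int R u pu ((i : int) * p %/ q.+1)%Z (x + _ / _)); congr u.
have q0 : q.+1%:R != 0 :> R by rewrite pnatr_eq0.
have := congr1 (fun z : int => z%:~R : R) (divz_eq ((i : int) * p) q.+1).
rewrite /= -sE rmorphD !rmorphM /= -!pmulrn => e.
rewrite mulrA -[RHS]addrA; congr (_ + _); apply: (mulIf q0).
by rewrite mulfVK// mulrDl mulfVK// e addrC.
Qed.

(** * Birkhoff sums of a Hölder continuous derivative *)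

Section holder_derivative.
Variables (R : realType) (alpha : R) (eps C : R) (u v : R -> R).
Hypothesis eps0 : 0 < eps.
Hypothesis uv : forall x : R, is_derive x 1 u (v x).
Hypothesis pu : forall t, u (t + 1) = u t.
Hypothesis hv : forall x y, `|v x - v y| <= C * `|x - y| `^ eps.

Let S := birkhoff R alpha.

Lemma derivative_periodic t : v (t + 1) = v t.
Proof.
have /@derive_val d := @is_derive_translate R u 1 t (v (t + 1)) (uv _).
have /@derive_val d' := uv t.
by rewrite -d -d'; congr ('D_1 _ t); apply/funext => y.
Qed.
Let pv := derivative_periodic.

Lemma holder_const_ge0 : 0 <= C.
Proof.
have := hv 1 0; rewrite subr0 normr1 powR1 mulr1; exact: le_trans.
Qed.
Let C0 := holder_const_ge0.

(* By the mean value theorem on each [x + j/q, x + (j+1)/q], the sum vanishes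
   after moving each sample point by at most 1/q. *)
Lemma equispaced_derivative_sum (q : nat) x : (0 < q)%N ->
  `|\sum_(j < q) v (x + j%:R / q%:R)| <= q%:R * (C * (q%:R^-1) `^ eps).
Proof.
move=> q0; have q0R : 0 < q%:R :> R by rewrite ltr0n.
have qn0 : q%:R != 0 :> R by rewrite gt_eqF.
pose pt (j : nat) := x + j%:R / q%:R.
have ptS j : pt j.+1 - pt j = q%:R^-1 by rewrite /pt -natr1; ring.
have cu z : {for z, continuous u}.
  by apply/differentiable_continuous/derivable1_diffP; case: (uv z).
have mvt (j : nat) : exists c : R, `|pt j - c| <= q%:R^-1 /\
    u (pt j.+1) - u (pt j) = v c / q%:R.
  have le : pt j <= pt j.+1 by rewrite -subr_ge0 ptS invr_ge0 ltW.
  have [c + ->] := @MVT_segment R u v (pt j) (pt j.+1) le (fun z _ => uv z)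
    (continuous_subspaceT cu).
  rewrite in_itv /= => /andP[c1 c2]; exists c; rewrite ptS; split => //.
  by rewrite distrC ger0_norm ?subr_ge0// -(ptS j) lerD2r.
pose c (j : nat) := projT1 (cid (mvt j)).
have cP (j : nat) : `|pt j - c j| <= q%:R^-1 /\ u (pt j.+1) - u (pt j) = v (c j) / q%:R.
  by rewrite /c; case: cid.
have v0 : \sum_(j < q) v (c j) = 0.
  apply: (mulIf (invr_neq0 qn0)); rewrite mul0r mulr_suml.
  rewrite -(eq_bigr _ (fun (j : 'I_q) _ => (cP j).2)).
  rewrite -(big_mkord xpredT (fun j => u (pt j.+1) - u (pt j))) telescope_sumr//.
  by rewrite /pt mul0r addr0 divff// pu subrr.
have -> : \sum_(j < q) v (x + j%:R / q%:R) = \sum_(j < q) (v (pt j) - v (c j)).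
  by rewrite sumrB v0 subr0.
rewrite (le_trans (ler_norm_sum _ _ _))//.
rewrite -[X in X%:R * _]card_ord mulr_natl -sumr_const ler_sum// => j _.
rewrite (le_trans (hv _ _))// ler_wpM2l// ge0_ler_powR ?nnegrE ?invr_ge0 ?(ltW eps0)//.
exact: (cP j).1.
Qed.

(** The case [q = 1] of the equispaced bound, where the sum is the single value [v x]. *)
Lemma derivative_bound x : `|v x| <= C.
Proof.
have := @equispaced_derivative_sum 1 x isT.
by rewrite big_ord1 mul0r addr0 invr1 powR1 mul1r mulr1.
Qed.

Lemma birkhoff_derivative_le (n : nat) x : `|S v n x| <= n%:R * C.
Proof.
rewrite (le_trans (ler_norm_sum _ _ _))//.
rewrite -[X in X%:R * _]card_ord mulr_natl -sumr_const ler_sum// => j _.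
exact: derivative_bound.
Qed.

Section approximant.
Variables (q : nat) (p : int).
Hypothesis q0 : (0 < q)%N.
Hypothesis cpq : coprimez p q.
Hypothesis qa : `|q%:R * alpha - p%:~R| <= q%:R^-1.
Let q0R : 0 < q%:R :> R. Proof. by rewrite ltr0n. Qed.

(** The error per step is at most [1/q^2], and at most [q] steps accumulate. *)
Let shift_close (i : nat) : (i <= q)%N ->
  `|i%:R * (p%:~R / q%:R) - i%:R * alpha| <= q%:R^-1.
Proof.
move=> iq; rewrite -mulrBr normrM normr_nat.
have -> : p%:~R / q%:R - alpha = - (q%:R * alpha - p%:~R) / q%:R by field;
  rewrite gt_eqF.
rewrite normrM normrN normfV normr_nat mulrCA -[X in _ <= X]mulr1.
by rewrite ler_pM// ?divr_ge0// ler_pdivrMr// mul1r ler_nat.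
Qed.

(** Replacing [alpha] by [p/q] turns the orbit into the equispaced grid; this replacement and the
    equispaced sum each cost [q C q^(-eps)]. *)
Lemma birkhoff_derivative_period x : `|S v q x| <= q%:R * (2 * C * (q%:R^-1) `^ eps).
Proof.
have := @equispaced_derivative_sum q x q0; rewrite -(@periodic_residue_sum _ _ _ p)//.
set A := \sum_(_ < _) _ => hA.
suff : `|S v q x - A| <= q%:R * (C * (q%:R^-1) `^ eps).
  have := ler_normD (S v q x - A) A; rewrite subrK; lra.
rewrite /S /birkhoff -sumrB (le_trans (ler_norm_sum _ _ _))//.
rewrite -[X in X%:R * _]card_ord mulr_natl -sumr_const ler_sum// => i _.
rewrite (le_trans (hv _ _))// ler_wpM2l// ge0_ler_powR ?nnegrE ?invr_ge0 ?(ltW eps0)//.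
by rewrite opprD addrACA subrr add0r distrC; apply: shift_close; apply: ltnW.
Qed.

(** The sum is cut into [m %/ q] full periods and a remainder of fewer than [q] terms, bounded
    trivially. *)
Lemma birkhoff_derivative_long (m : nat) x :
  `|S v m x| <= m%:R * (2 * C * (q%:R^-1) `^ eps) + q%:R * C.
Proof.
rewrite {1}(divn_eq m q) /S birkhoffD birkhoffM (le_trans (ler_normD _ _))//.
rewrite lerD//; last first.
  by rewrite (le_trans (birkhoff_derivative_le _ _))// ler_wpM2r// ler_nat ltnW//
    ltn_mod.
apply: (@le_trans _ _ ((m %/ q)%:R * (q%:R * (2 * C * (q%:R^-1) `^ eps)))).
  rewrite (le_trans (ler_norm_sum _ _ _))//.
  rewrite -[X in X%:R * _]card_ord mulr_natl -sumr_const ler_sum// => i _.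
  exact: birkhoff_derivative_period.
by rewrite mulrA -natrM ler_wpM2r ?ler_nat ?leq_trunc_div// !mulr_ge0 ?powR_ge0.
Qed.

(* [S u q (z + i alpha) - S u q z = S u i (z + q alpha) - S u i z] is small, and
   the points [z + i alpha], [i < q], are [2/q]-dense modulo 1. *)
Lemma birkhoff_oscillation (B kappa : R) :
  `|q%:R * alpha - p%:~R| <= kappa ->
  (forall i x, (i < q)%N -> `|S v i x| <= B) ->
  forall y z, `|S u q y - S u q z| <= B * kappa + 4 * C * (q%:R^-1) `^ eps.
Proof.
move=> qk hB y z.
(* The grid point just below [y - z] is [j/q]; the Bezout coefficient [a] inverts [p] modulo [q],
   which gives [i < q] with [i p = j + l q]. *)
pose j := Num.floor (q%:R * (y - z)).
have [[a b]] := coprimezP _ _ cpq; rewrite /= => ab.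
pose i := `|(j * a %% q)%Z|%N.
have iE : (i : int) = (j * a %% q)%Z by rewrite /i gez0_abs// modz_ge0// -lt0n.
have iq : (i < q)%N by rewrite -ltz_nat iE ltz_pmod.
have [l il] : exists l : int, (i : int) * p = j + l * q.
  exists (- (j * a %/ q)%Z * p - j * b).
  have -> : (i : int) = j * a - (j * a %/ q)%Z * q.
    by rewrite {1}(divz_eq (j * a) q) iE addrC addKr.
  have e : j = j * a * p + j * b * q by rewrite -!mulrA -mulrDr ab mulr1.
  by rewrite {3}e; ring.
have ilR : i%:R * (p%:~R / q%:R) = j%:~R / q%:R + l%:~R :> R.
  have := congr1 (fun t : int => t%:~R : R) il.
  rewrite /= rmorphD !rmorphM /= -!pmulrn => e.
  by rewrite mulrA e mulrDl mulfK ?gt_eqF.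
have step : `|S u q (z + i%:R * alpha) - S u q z| <= B * kappa.
  rewrite birkhoff_coboundary -(birkhoff_int _ _ _ _ pu (- p)).
  apply: le_trans (is_derive_lipschitz _ _ _ B
    (@is_derive_birkhoff R alpha u v i uv) (fun x => hB i x iq) _ _) _.
  have B0 : 0 <= B by apply: le_trans (hB i 0 iq).
  rewrite ler_wpM2l//; apply: le_trans qk.
  by rewrite rmorphN /= (_ : _ - _ = q%:R * alpha - p%:~R)//; ring.
(* One [1/q] comes from rounding [y - z] down to [j/q], the other from replacing [p/q] by
   [alpha]. *)
have near : `|y - (z + i%:R * alpha + (- l)%:~R)| <= 2 * q%:R^-1.
  have := shift_close i (ltnW iq); rewrite ilR rmorphN /=.
  have f1 : 0 <= y - z - j%:~R / q%:R.
    by rewrite subr_ge0 ler_pdivrMr// [_ * q%:R]mulrC ge_floor.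
  have f2 : y - z - j%:~R / q%:R <= q%:R^-1.
    have e : (j%:~R + 1) / q%:R = j%:~R / q%:R + q%:R^-1 :> R by rewrite mulrDl mul1r.
    rewrite lerBlDl -e ler_pdivlMr// [_ * q%:R]mulrC.
    by rewrite -intrD1 ltW// floorD1_gt.
  by rewrite !ler_norml; move=> /andP[]*; apply/andP; split; lra.
have := is_derive_lipschitz _ _ _ _ (@is_derive_birkhoff R alpha u v q uv)
  birkhoff_derivative_period y (z + i%:R * alpha + (- l)%:~R).
rewrite -/S [S u q (_ + _%:~R)]birkhoff_int// => lip.
(* A slope of at most [2 C q^(1 - eps)] acts over a distance of at most [2/q]. *)
have : `|S u q y - S u q (z + i%:R * alpha)| <= 4 * C * (q%:R^-1) `^ eps.
  apply: le_trans lip _.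
  apply: (@le_trans _ _ (q%:R * (2 * C * (q%:R^-1) `^ eps) * (2 * q%:R^-1))).
    by rewrite ler_wpM2l// !mulr_ge0 ?powR_ge0 ?ler0n.
  rewrite le_eqVlt; apply/orP; left; apply/eqP.
  by set w := _ `^ _; field; rewrite gt_eqF.
have := ler_normD (S u q y - S u q (z + i%:R * alpha)) (S u q (z + i%:R * alpha) - S
  u q z).
rewrite addrA subrK; lra.
Qed.

End approximant.
End holder_derivative.

Lemma invn_itv (R : realType) (q : nat) : (0 < q)%N -> 0 < (q%:R^-1 : R) <= 1.
Proof. by move=> q0; rewrite invr_gt0 ltr0n q0 invf_le1 ?ltr0n// ler1n. Qed.

Lemma truncn_half (R : realType) (s : R) : 1 <= s ->
  [/\ (0 < Num.truncn s)%N, (Num.truncn s)%:R <= s & (Num.truncn s)%:R^-1 <= 2 * s^-1].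
Proof.
move=> s1; have s0 : 0 <= s by lra.
have /andP[t1 t2] := truncn_itv s0.
have t0 : (0 < Num.truncn s)%N by rewrite truncn_gt0.
split=> //; rewrite -[2]invrK -invfM lef_pV2 ?posrE ?mulr_gt0 ?invr_gt0 ?ltr0n//;
  last by lra.
move: t2; rewrite -natr1; have : 1 <= (Num.truncn s)%:R :> R by rewrite ler1n.
lra.
Qed.

(** * Birkhoff sums uniformly close to integers *)

Section approximate_coboundary.
Variables (R : realType) (alpha : R) (eps C : R) (u v : R -> R).
Hypothesis ira : irrational alpha.
Hypothesis eps0 : 0 < eps.
Hypothesis eps1 : eps < 1.
Hypothesis uv : forall x : R, is_derive x 1 u (v x).
Hypothesis pu : forall t, u (t + 1) = u t.
Hypothesis hv : forall x y, `|v x - v y| <= C * `|x - y| `^ eps.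

Let S := birkhoff R alpha.
Let C0 : 0 <= C. Proof. exact: holder_const_ge0 hv. Qed.

(** [birkhoff_oscillation] is applied with [B = q C] and [kappa = q^(-2)] when such approximations
    recur, and otherwise with [B] of order [q^(1 - eps/4)] and [kappa = 1/q]. *)
Lemma small_oscillation : exists2 C' : R, 0 <= C' & forall N : nat,
  exists2 q : nat, (N <= q)%N && (0 < q)%N &
    forall y z, `|S u q y - S u q z| <= C' * (q%:R^-1) `^ (eps / 4).
Proof.
have powe (q : nat) (x : R) : (0 < q)%N -> eps / 4 <= x ->
    (q%:R^-1 : R) `^ x <= q%:R^-1 `^ (eps / 4).
  by move=> q0; apply: ger_powR; exact: invn_itv.
have osc (q : nat) (p : int) (B kappa D : R) : (0 < q)%N -> coprimez p q ->
    `|q%:R * alpha - p%:~R| <= kappa -> kappa <= q%:R^-1 ->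
    (forall i x, (i < q)%N -> `|S v i x| <= B) ->
    B * kappa <= D * q%:R^-1 `^ (eps / 4) ->
    forall y z, `|S u q y - S u q z| <= (D + 4 * C) * q%:R^-1 `^ (eps / 4).
  move=> q0 cpq qk kq hB hD y z.
  apply: le_trans (birkhoff_oscillation R alpha eps C u v eps0 uv pu hv q p q0 cpq
    (le_trans qk kq) B kappa qk hB y z) _.
  by rewrite (mulrDl D) lerD// ler_wpM2l ?mulr_ge0// powe//; move: eps0; lra.
have [often|] := pselect (forall N : nat, exists (q : nat) (p : int),
  [/\ (N <= q)%N, (0 < q)%N, coprimez p q & `|q%:R * alpha - p%:~R| <= (q%:R ^+ 2)^-1]).
  exists (C + 4 * C); first by rewrite addr_ge0// mulr_ge0.
  move=> N; have [q [p [Nq q0 cpq qa]]] := often N; exists q; first by rewrite Nq.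
  have q0R : 0 < q%:R :> R by rewrite ltr0n.
  apply: (osc q p (q%:R * C) _ C q0 cpq qa).
  - rewrite lef_pV2 ?posrE ?exprn_gt0// -[X in X <= _]mulr1 expr2 ler_wpM2l ?ler1n//.
  - move=> i x iq; apply: le_trans (birkhoff_derivative_le R alpha eps C u v eps0 uv
    pu hv i x) _.
    by rewrite ler_wpM2r// ler_nat ltnW.
  have -> : q%:R * C * (q%:R ^+ 2)^-1 = C * q%:R^-1 by field; rewrite gt_eqF.
  rewrite ler_wpM2l// -[X in X <= _]powRr1 ?invr_ge0 ?ler0n// powe//.
  by move: eps1; lra.
move=> /existsNP[N0 rare].
have {}rare (q : nat) (p : int) : (N0.+1 <= q)%N -> coprimez p q ->
    (q%:R ^+ 2)^-1 < `|q%:R * alpha - p%:~R|.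
  move=> Nq cpq; rewrite ltNge; apply/negP => h; apply: rare; exists q, p.
  by split=> //; [exact: ltnW|apply: leq_ltn_trans Nq].
exists (5 * C + 4 * C); first by rewrite addr_ge0// mulr_ge0.
(* The threshold [Q0] for an auxiliary denominator [q'] is fixed first, so that [q] can be taken
   above [Q0.+1 ^ 4], whence [t >= Q0.+1] below. *)
move=> N; have [Q0 HQ0] := dirichlet_large R alpha ira N0.+1.
have [Q1 /(_ (maxn Q1 1))] := dirichlet_large R alpha ira (maxn N (Q0.+1 ^ 4)).
rewrite leq_max leqnn leq_max orbT => /(_ isT isT) [q [p [/andP[]]]].
rewrite geq_max => /andP[Nq Qq] qQ1 cpq qa.
have q0 : (0 < q)%N by apply: leq_trans Qq; rewrite expn_gt0.
have q0R : 0 < q%:R :> R by rewrite ltr0n.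
have {qQ1}qa : `|q%:R * alpha - p%:~R| <= q%:R^-1.
  by apply: le_trans qa _; rewrite lef_pV2 ?posrE ?ler_nat// ltr0n (leq_trans q0).
exists q; first by rewrite Nq.
(* With [t] of order [q^(1/4)], Dirichlet's theorem with bound [t^2] yields [t < q' <= t^2]: then
   [q'^(-eps)] is [O(q^(-eps/4))] while [q'] is at most [q^(1/2)]. *)
pose s : R := q%:R `^ 4^-1.
have s4 : s ^+ 4 = q%:R by rewrite -powR_mulrn ?powR_ge0// -powRrM mulVf// powRr1// ltW.
have sQ : Q0.+1%:R <= s.
  by rewrite -(@ler_pXn2r _ 4)// ?nnegrE ?ler0n ?powR_ge0// s4 -natrX ler_nat.
have s1 : 1 <= s by apply: le_trans sQ; rewrite ler1n.
have [] := truncn_half R s s1; set t := Num.truncn s => t0 ts tV.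
have tQ : (Q0.+1 <= t)%N by rewrite /t truncn_ge_nat// (le_trans _ s1).
have t20 : (0 < t ^ 2)%N by rewrite expn_gt0 t0.
have t2R : 0 < (t ^ 2)%:R :> R by rewrite ltr0n.
have Q0t : (Q0 <= t ^ 2)%N by apply: leq_trans (ltnW tQ) _; rewrite -mulnn leq_pmulr.
have [q' [p' [/andP[Nq' q't] cpq' qa']]] := HQ0 (t ^ 2)%N Q0t t20.
have q'0 : (0 < q')%N by apply: leq_trans Nq'.
have q'0R : 0 < q'%:R :> R by rewrite ltr0n.
(* If [q' <= t], then [|q' alpha - p'| > q'^(-2) >= t^(-2)], contrary to the choice of [q']. *)
have tq' : (t < q')%N.
  have := lt_le_trans (rare q' p' Nq' cpq') qa'.
  rewrite ltf_pV2 ?posrE ?exprn_gt0// natrX ltr_pXn2r ?nnegrE ?ler0n//.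
  by rewrite ltr_nat.
have {}qa' : `|q'%:R * alpha - p'%:~R| <= q'%:R^-1.
  by apply: le_trans qa' _; rewrite lef_pV2 ?posrE// ler_nat.
have tpow : (t%:R^-1 : R) `^ eps <= 2 * q%:R^-1 `^ (eps / 4).
  apply: (@le_trans _ _ ((2 * s^-1) `^ eps)).
    by rewrite ge0_ler_powR ?nnegrE ?invr_ge0 ?mulr_ge0 ?invr_ge0 ?powR_ge0 ?(ltW
      eps0)//.
  rewrite powRM ?invr_ge0 ?powR_ge0// ler_pM ?powR_ge0//.
    by apply: ler1_powR; [lra|exact: ltW].
  rewrite /s -powRN -powRrM -[q%:R^-1]powR_inv1 ?ler0n// -powRrM.
  by rewrite le_eqVlt; apply/orP; left; apply/eqP; congr (_ `^ _); field.
(* Here [s^2 = q^(1/2) = q q^(-1/2)], and [eps / 4 < 1/2]. *)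
have t2pow : t%:R ^+ 2 <= q%:R * q%:R^-1 `^ (eps / 4).
  apply: (@le_trans _ _ (s ^+ 2)); first by rewrite ler_pXn2r ?nnegrE ?ler0n ?powR_ge0.
  have s2 : s ^+ 2 = q%:R * (s ^+ 2)^-1.
    rewrite -s4; have : s != 0 by rewrite gt_eqF//; lra.
    by move=> ?; field.
  rewrite s2 ler_wpM2l ?ler0n// -powR_mulrn ?powR_ge0// -powRrM -powRN.
  rewrite -[q%:R^-1]powR_inv1 ?ler0n// -powRrM; apply: ler_powR; first by rewrite ler1n.
  by move: eps1; lra.
(* The constant 5 is [2 * 2] from the full periods, one factor 2 being lost in truncating [s], plus
   1 from the remainder. *)
apply: (osc q p (5 * C * (q%:R * q%:R^-1 `^ (eps / 4))) q%:R^-1 (5 * C) q0 cpq qa).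
- by [].
- move=> i x iq.
  apply: le_trans (birkhoff_derivative_long R alpha eps C u v eps0 uv pu hv q' p' q'0
    cpq' qa' i x) _.
  have h1 : (q'%:R^-1 : R) `^ eps <= 2 * q%:R^-1 `^ (eps / 4).
    apply: le_trans tpow; rewrite ge0_ler_powR ?nnegrE ?invr_ge0 ?(ltW eps0)//.
    by rewrite lef_pV2 ?posrE ?ltr0n// ler_nat ltnW.
  have h2 : q'%:R <= q%:R * q%:R^-1 `^ (eps / 4) :> R.
    by apply: le_trans t2pow; rewrite -natrX ler_nat.
  set w := _ `^ (eps / 4) in h1 h2 *.
  apply: (@le_trans _ _ (q%:R * (2 * C * (2 * w)) + q%:R * w * C)).
    rewrite lerD ?ler_wpM2r// ler_pM ?ler0n ?mulr_ge0 ?powR_ge0//.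
      by rewrite ler_nat ltnW.
    by rewrite ler_wpM2l// mulr_ge0.
  by rewrite le_eqVlt; apply/orP; left; apply/eqP; ring.
rewrite le_eqVlt; apply/orP; left; apply/eqP.
by set w := _ `^ _; field; rewrite gt_eqF.
Qed.

(** With [theta = S u q 0], the sum of length [k q] is [k theta] up to [k] times the oscillation,
    and Dirichlet's theorem with a bound of order [q^(eps/8)] brings [k theta] near an integer. *)
Lemma birkhoff_near_int : exists2 C' : R, 0 <= C' & forall N : nat,
  exists2 r : nat, (N <= r)%N && (0 < r)%N &
    forall x, exists l : int, `|S u r x - l%:~R| <= C' * (r%:R^-1) `^ (eps / 16).
Proof.
have [C' C'0 HC'] := small_oscillation; exists (C' + 2); first by lra.
move=> N; have [q /andP[Nq q0] osc] := HC' N.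
have q0R : 0 < q%:R :> R by rewrite ltr0n.
have q1R : 1 <= q%:R :> R by rewrite ler1n.
(* Of the exponent [eps / 4 = b + b], one half is lost to the factor [k <= q^b] and the other
   remains as the rate. *)
pose b := eps / 8; have b0 : 0 <= b by rewrite /b; move: eps0; lra.
have b1 : b <= 1 by rewrite /b; move: eps1; lra.
pose s : R := q%:R `^ b.
have s1 : 1 <= s by rewrite -(powRr0 q%:R) ler_powR.
have [] := truncn_half R s s1; set K := Num.truncn s => K0 Ks KV.
have [k [l [k0 kK kl]]] := dirichlet R (S u q 0) K K0.
exists (k * q)%N.
  by rewrite muln_gt0 k0 q0 andbT (leq_trans Nq)// leq_pmull.
move=> x; exists l.
have sV : s^-1 = q%:R^-1 `^ b by rewrite /s -powRN -[q%:R^-1]powR_inv1 ?ler0n//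
  -powRrM mulN1r.
have h1 : `|S u (k * q) x - k%:R * S u q 0| <= C' * q%:R^-1 `^ b.
  rewrite /S birkhoffM -/S.
  have -> : k%:R * S u q 0 = \sum_(j < k) S u q 0 by rewrite sumr_const card_ord
    mulr_natl.
  rewrite -sumrB (le_trans (ler_norm_sum _ _ _))//.
  apply: (@le_trans _ _ (k%:R * (C' * q%:R^-1 `^ (eps / 4)))).
    rewrite -[X in X%:R * _]card_ord mulr_natl -sumr_const ler_sum//.
  have -> : eps / 4 = b + b by rewrite /b; field.
  rewrite powRD; last by rewrite invr_eq0 pnatr_eq0 -lt0n q0 implybT.
  rewrite mulrCA ler_wpM2l// mulrA ler_piMl ?powR_ge0//.
  rewrite -sV ler_pdivrMr ?mul1r; last by lra.
  by apply: le_trans Ks; rewrite ler_nat.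
have h2 : `|k%:R * S u q 0 - l%:~R| <= 2 * q%:R^-1 `^ b.
  by rewrite -sV; apply: le_trans KV.
apply: (@le_trans _ _ ((C' + 2) * q%:R^-1 `^ b)).
  rewrite (mulrDl C') (le_trans _ (lerD h1 h2))//.
  by have := ler_normD (S u (k * q) x - k%:R * S u q 0) (k%:R * S u q 0 - l%:~R);
    rewrite addrA subrK.
rewrite ler_wpM2l; [by []|by lra|].
(* Since [k <= q^b <= q], the length [k q] is at most [q^2], which halves the exponent once more. *)
have -> : b = 2 * (eps / 16) by rewrite /b; field.
rewrite powRrM powR_mulrn ?invr_ge0 ?ler0n//.
rewrite ge0_ler_powR ?nnegrE ?invr_ge0 ?exprn_ge0 ?invr_ge0 ?ler0n//;
  first by move: eps0; lra.
rewrite exprVn lef_pV2 ?posrE ?exprn_gt0 ?ltr0n ?muln_gt0 ?k0//.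
rewrite natrM expr2 ler_wpM2r ?ler0n//.
apply: (@le_trans _ _ s); first by apply: le_trans Ks; rewrite ler_nat.
exact: ler1_powR.
Qed.

End approximate_coboundary.

(** * The exponential on the circle *)

Local Notation normc := ComplexField.Normc.normc.

Lemma normr_normc (R : realType) (z : R[i]) : `|z| = (normc z)%:C.
Proof. by case: z. Qed.

Lemma normc_ge0 (R : realType) (z : R[i]) : 0 <= normc z.
Proof. by rewrite -ler0c -normr_normc. Qed.

Lemma normc_distC (R : realType) (z w : R[i]) : normc (z - w) = normc (w - z).
Proof. by apply: (@complexI R); rewrite -!normr_normc distrC. Qed.

Lemma normc_distD (R : realType) (y z w : R[i]) :
  normc (z - w) <= normc (z - y) + normc (y - w).
Proof. by rewrite -lecR rmorphD /= -!normr_normc ler_distD. Qed.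

Lemma continuous_normcP (R : realType) (X : topologicalType)
    (f : X -> (R[i] : numFieldType)) (x : X) :
  {for x, continuous f} <->
  (forall e : R, 0 < e -> \forall y \near x, normc (f x - f y) < e).
Proof.
split=> [/cvgrPdist_lt H e e0|H].
  have e0C : (0 : R[i]) < e%:C by rewrite ltcR.
  by apply: filterS (H _ e0C) => y; rewrite normr_normc ltcR.
(* Positivity in [R[i]] forces a zero imaginary part, so real radii suffice. *)
apply/cvgrPdist_lt => -[e e']; rewrite ltcE /= => /andP[/eqP -> e0].
by apply: filterS (H e e0) => y; rewrite normr_normc ltcR.
Qed.

(** * Quantitative separation on a compact space *)

Lemma continuous_normc_dist (R : realType) (X : topologicalType)
    (f : X -> (R[i] : numFieldType)) : continuous f ->
  continuous (fun p : X * X => normc (f p.1 - f p.2)).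
Proof.
move=> cf [x y]; apply/cvgrPdist_lt => e e0.
have e20 : 0 < e / 2 by rewrite divr_gt0.
have Hx := (continuous_normcP R X f x).1 (cf x) _ e20.
have Hy := (continuous_normcP R X f y).1 (cf y) _ e20.
exists ([set x' | normc (f x - f x') < e / 2],
  [set y' | normc (f y - f y') < e / 2]) => //.
move=> [x' y'] /= [hx hy].
have := normc_distD R (f x') (f x) (f y); have := normc_distD R (f y') (f x') (f y).
have := normc_distD R (f x) (f x') (f y'); have := normc_distD R (f y) (f x) (f y').
rewrite [normc (f x' - f x)]normc_distC [normc (f y' - f y)]normc_distC.
by rewrite ltr_norml => *; apply/andP; split; lra.
Qed.

(* [X * X] being compact, a sequence of counterexamples, one for each [n], would
   have a cluster point, which is excluded both on and off the diagonal. *)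
Lemma compact_separating_bound (R : realType) (X : topologicalType)
    (f : X -> (R[i] : numFieldType)) (phi : nat -> X -> (R[i] : numFieldType)) :
  compact [set: X] -> continuous f -> (forall i, continuous (phi i)) ->
  (forall x y, (forall i, phi i x = phi i y) -> x = y) ->
  forall eta : R, 0 < eta -> exists n : nat, forall x y,
    normc (f x - f y) <= eta + n%:R * \sum_(i < n) normc (phi i x - phi i y) ^+ 2.
Proof.
move=> cX cf cphi sep eta eta0; apply: contrapT => /forallNP no.
have bad (n : nat) : exists p : X * X,
    eta + n%:R * \sum_(i < n) normc (phi i p.1 - phi i p.2) ^+ 2 < normc (f p.1 - f
      p.2).
  have /existsNP[x /existsNP[y /negP]] := no n.
  by rewrite -ltNge => h; exists (x, y).
pose p n := projT1 (cid (bad n)).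
have pP n : eta + n%:R * \sum_(i < n) normc (phi i (p n).1 - phi i (p n).2) ^+ 2
    < normc (f (p n).1 - f (p n).2) by rewrite /p; case: cid.
have := compact_setX cX cX; rewrite setXTT => /(_ (p @ \oo) _ filterT).
move=> [[x y] [_ cl]].
have {}cl (U : set (X * X)) (N : nat) : nbhs (x, y) U ->
  exists2 n : nat, (N <= n)%N & U (p n).
  move=> xyU; have [|_ [[n /= Nn <-] Un]] := cl (p @` [set n | (N <= n)%N]) U _ xyU.
    by exists N => // n /= Nn; exists n.
  by exists n.
have [xy|/eqP xy] := eqVneq (x : X) y.
  have [|n _] := cl [set q : X * X | normc (f q.1 - f q.2) < eta] 0%N.
    have /cvgrPdist_lt/(_ eta eta0) := continuous_normc_dist R X f cf (x, y).
    apply: filterS => q /=; rewrite xy subrr ComplexField.Normc.normc0 sub0r normrN.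
    exact: le_lt_trans (ler_norm _).
  move=> /= h; have := lt_trans (pP n) h; rewrite ltNge lerDl.
  by rewrite mulr_ge0 ?ler0n ?sumr_ge0// => i _; rewrite sqr_ge0.
have [i phixy] : exists i, phi i x <> phi i y.
  by apply: contrapT => /forallNP h; apply: xy; apply: sep => i; apply: contrapT.
pose c := normc (phi i x - phi i y).
have c0 : 0 < c.
  rewrite lt_neqAle normc_ge0 andbT eq_sym; apply/eqP => /ComplexField.Normc.eq0_normc.
  by move=> /subr0_eq.
have c20 : 0 < c / 2 by rewrite divr_gt0.
pose B := normc (f x - f y) + 1.
(* For [n > N] the product [n (c/2)^2] exceeds [B], which bounds the variation of [f] near
   [(x, y)]. *)
pose N := Num.truncn (B / (c / 2) ^+ 2).
have [|n] := cl [set q : X * X | normc (f q.1 - f q.2) < B /\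
    c / 2 < normc (phi i q.1 - phi i q.2)] (maxn N.+1 i.+1).
  have /cvgrPdist_lt/(_ 1 ltr01) h1 := continuous_normc_dist R X f cf (x, y).
  have /cvgrPdist_lt/(_ _ c20) h2 := continuous_normc_dist R X _ (cphi i) (x, y).
  apply: filterS2 h1 h2 => q /=; rewrite -/c /B !ltr_norml => /andP[? ?] /andP[? ?].
  by split; lra.
rewrite geq_max => /andP[Nn ni] [fB phic].
have h1 : (c / 2) ^+ 2 <= \sum_(j < n) normc (phi j (p n).1 - phi j (p n).2) ^+ 2.
  rewrite (bigD1 (Ordinal ni))//= -[X in X <= _]addr0 lerD//.
    by rewrite ler_pXn2r ?nnegrE ?normc_ge0 ?ltW.
  by rewrite sumr_ge0// => j _; rewrite sqr_ge0.
have h2 : B < n%:R * (c / 2) ^+ 2.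
  rewrite -ltr_pdivrMr ?exprn_gt0//; apply: lt_le_trans (truncnS_gt _) _.
  by rewrite ler_nat.
have h3 : n%:R * (c / 2) ^+ 2 <= n%:R * \sum_(j < n) normc (phi j (p n).1 - phi j (p
  n).2) ^+ 2.
  by rewrite ler_wpM2l.
have := pP n; lra.
Qed.

(** This is [exp(2 pi i t)]. *)
Definition expi (R : realType) (t : R) : R[i] :=
  cos (t * pi *+ 2) +i* sin (t * pi *+ 2).

Lemma expiD (R : realType) (s t : R) : expi R (s + t) = expi R s * expi R t.
Proof.
rewrite /expi mulrDl mulrnDl (cosD (s * pi *+ 2)) (sinD (s * pi *+ 2)); simpc.
by rewrite [cos _ * sin _ + _]addrC.
Qed.

Lemma expi0 (R : realType) : expi R 0 = 1.
Proof. by rewrite /expi mul0r mul0rn cos0 sin0. Qed.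

Lemma expi_neq0 (R : realType) (t : R) : expi R t != 0.
Proof.
apply/eqP => t0; have := expiD R t (- t).
by rewrite subrr expi0 t0 mul0r => /eqP; rewrite oner_eq0.
Qed.

Lemma expiN (R : realType) (t : R) : expi R (- t) = (expi R t)^-1.
Proof.
apply: (mulfI (expi_neq0 R t)).
by rewrite -expiD subrr expi0 divff// expi_neq0.
Qed.

Lemma expiMn (R : realType) (t : R) (n : nat) : expi R (t *+ n) = expi R t ^+ n.
Proof.
by elim: n => [|n IH]; [rewrite mulr0n expr0 expi0|rewrite mulrS exprS expiD IH].
Qed.

Lemma normc_expi (R : realType) (t : R) : normc (expi R t) = 1.
Proof. by rewrite /= cos2Dsin2 sqrtr1. Qed.

Lemma expi_conj (R : realType) (t : R) : (expi R t)^*%C = (expi R t)^-1.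
Proof. by rewrite -expiN /expi mulNr mulNrn cosN sinN. Qed.

Lemma expi_int (R : realType) (m : int) : expi R m%:~R = 1.
Proof.
have e1 : expi R 1 = 1.
  by rewrite /expi mul1r cos2pi sin2pi.
have en (n : nat) : expi R n%:R = 1 by rewrite expiMn e1 expr1n.
by case: m => n; [rewrite en|rewrite NegzE rmorphN /= expiN en invr1].
Qed.

(** For the fractional part [s], [cos(2 pi s) = 1] means [sin(pi s) = 0], while the sine is positive
    on []0, pi[]. *)
Lemma expi_eq1 (R : realType) (t : R) : expi R t = 1 -> t \is a Num.int.
Proof.
pose s := t - (Num.floor t)%:~R.
have -> : t = s + (Num.floor t)%:~R by rewrite subrK.
have s0 : 0 <= s by rewrite subr_ge0 ge_floor.
have s1 : s < 1 by rewrite ltrBlDl -intrD1 floorD1_gt.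
rewrite expiD expi_int mulr1 => -[c1 _].
suff -> : s = 0 by rewrite add0r intr_int.
apply/eqP; apply/negPn/negP => sn0.
have sp0 : 0 < s by rewrite lt_neqAle eq_sym sn0.
have : 0 < sin (s * pi).
  by apply: sin_gt0_pi; rewrite mulr_gt0 ?pi_gt0//= gtr_pMl ?pi_gt0.
have := cos2Dsin2 (s * pi); move: c1; rewrite cos_mulr2n => c1 c2 sp.
have : sin (s * pi) ^+ 2 = 0 by rewrite -mulr_natr in c1; lra.
by move=> /eqP; rewrite expf_eq0 /= gt_eqF.
Qed.

(** Real and imaginary parts are bounded separately, each by [2 pi |t|]. *)
Lemma expi_dist1 (R : realType) (t : R) : normc (expi R t - 1) <= 4 * pi * `|t|.
Proof.
set x := t * pi *+ 2.
have xE : `|x| = 2 * pi * `|t|.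
  by rewrite /x normrMn normrM (gtr0_norm (pi_gt0 R)) -mulr_natl; ring.
have -> : expi R t - 1 = (cos x - 1)%:C + (0 +i* sin x).
  by rewrite /expi -/x; simpc.
apply: le_trans (le_normcD _ _) _.
have hc : `|cos x - cos 0| <= 1 * `|x - 0|.
  apply: (is_derive_lipschitz R cos (fun t => - sin t)) => y.
  by rewrite normrN ler_norml sin_geN1 sin_le1.
have hs : `|sin x - sin 0| <= 1 * `|x - 0|.
  apply: (is_derive_lipschitz R sin cos) => y.
  by rewrite ler_norml cos_geN1 cos_le1.
rewrite cos0 sin0 !mul1r !subr0 in hc hs.
rewrite /= expr0n /= !addr0 add0r !sqrtr_sqr.
have -> : 4 * pi * `|t| = `|x| + `|x| by rewrite xE; ring.
exact: lerD.
Qed.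

Lemma expi_dist1_int (R : realType) (t d : R) (l : int) :
  `|t - l%:~R| <= d -> normc (expi R t - 1) <= 4 * pi * d.
Proof.
move=> h; rewrite -[t](subrK l%:~R) expiD expi_int mulr1.
by apply: le_trans (expi_dist1 R _) _; rewrite ler_wpM2l// mulr_ge0 ?pi_ge0.
Qed.

Lemma expi_lipschitz (R : realType) (s t : R) :
  normc (expi R s - expi R t) <= 4 * pi * `|s - t|.
Proof.
have -> : expi R s - expi R t = expi R t * (expi R (s - t) - 1).
  by rewrite mulrBr -expiD mulr1 [t + _]addrC subrK.
by rewrite ComplexField.Normc.normcM normc_expi mul1r expi_dist1.
Qed.

Lemma expi_continuous (R : realType) : continuous (expi R : R -> (R[i] : numFieldType)).
Proof.
move=> t; apply/continuous_normcP => e e0.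
have pi4 : 0 < 4 * pi :> R by rewrite mulr_gt0 ?pi_gt0.
exists (e / (4 * pi)); first by rewrite /= divr_gt0.
move=> s /= ts.
apply: le_lt_trans (expi_lipschitz R t s) _.
by rewrite mulrC -ltr_pdivlMr.
Qed.

Definition cexp (R : realType) (c : circle R) : (R[i] : numFieldType) :=
  expi R (repr c).

Lemma cexp_to_circle (R : realType) (t : R) : cexp R (to_circle t) = expi R t.
Proof.
by rewrite /cexp; have [m ->] := repr_to_circle t; rewrite expiD expi_int mulr1.
Qed.

Lemma to_circle_repr (R : realType) (c : circle R) : to_circle (repr c) = c.
Proof. by rewrite /to_circle reprK. Qed.

Lemma cexpD (R : realType) (c d : circle R) : cexp R (c + d) = cexp R c * cexp R d.
Proof.
by rewrite -(to_circle_repr R c) -(to_circle_repr R d) -to_circleD !cexp_to_circle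
  expiD.
Qed.

Lemma cexp_continuous (R : realType) : continuous (cexp R).
Proof.
apply/quotient_continuous.
rewrite (_ : _ \o _ = expi R); first exact: expi_continuous.
by apply/funext => t /=; exact: cexp_to_circle.
Qed.

Lemma cexp_inj (R : realType) : injective (cexp R).
Proof.
move=> c d; rewrite -(to_circle_repr R c) -(to_circle_repr R d) !cexp_to_circle => e.
apply/to_circleP; apply: expi_eq1.
by rewrite expiD expiN e divff// expi_neq0.
Qed.

(** * Density of the trigonometric polynomials on the torus *)

Section linear_span_algebra.
Variables (K : numFieldType) (X : Type) (F : set (X -> K)).

Lemma linear_span_sub f : F f -> linear_span F f.
Proof.
move=> Ff; exists 1%N, (fun=> 1), (fun=> f); split=> // x.
by rewrite big_ord1 mul1r.
Qed.

Lemma linear_span_scale a f : linear_span F f -> linear_span F (fun x => a * f x).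
Proof.
move=> [n [c [g [Fg fE]]]]; exists n, (fun i => a * c i), g; split=> // x.
by rewrite fE mulr_sumr; apply: eq_bigr => i _; rewrite mulrA.
Qed.

Lemma linear_span_add f g : linear_span F f -> linear_span F g ->
  linear_span F (fun x => f x + g x).
Proof.
move=> [n [c [f' [Ff fE]]]] [m [d [g' [Fg gE]]]].
exists (n + m)%N, (fun i => match fintype.split i with inl j => c j | inr j => d j end),
  (fun i => match fintype.split i with inl j => f' j | inr j => g' j end); split.
  by move=> i; case: (fintype.split i).
move=> x; rewrite fE gE big_split_ord /=; congr (_ + _); apply: eq_bigr => i _.
  by rewrite (unsplitK (inl i)).
by rewrite (unsplitK (inr i)).
Qed.

Lemma linear_span_sum (I : Type) (r : seq I) (f : I -> X -> K) :
  (forall i, linear_span F (f i)) -> linear_span F (fun x => \sum_(i <- r) f i x).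
Proof.
move=> Hf; elim: r => [|i r IH].
  exists 0%N, (fun=> 0), (fun=> fun=> 0); split=> [[]//|x].
  by rewrite big_nil big_ord0.
have := linear_span_add _ _ (Hf i) IH.
by congr linear_span; apply/funext => x; rewrite big_cons.
Qed.

Hypothesis F1 : F (fun=> 1).
Hypothesis FM : forall f g, F f -> F g -> F (fun x => f x * g x).

Lemma linear_span_mul f g : linear_span F f -> linear_span F g ->
  linear_span F (fun x => f x * g x).
Proof.
move=> [n [c [f' [Ff fE]]]] [m [d [g' [Fg gE]]]].
have -> : (fun x => f x * g x) = (fun x => \sum_(i < n) c i * (\sum_(j < m) d j * (f'
  i x * g' j x))).
  apply/funext => x; rewrite fE gE mulr_suml; apply: eq_bigr => i _.
  by rewrite mulr_sumr mulr_sumr; apply: eq_bigr => j _; ring.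
apply: linear_span_sum => i; apply: linear_span_scale; apply: linear_span_sum => j.
by apply: linear_span_scale; apply: linear_span_sub; exact: FM.
Qed.

Lemma linear_span_prod (I : Type) (r : seq I) (f : I -> X -> K) :
  (forall i, linear_span F (f i)) -> linear_span F (fun x => \prod_(i <- r) f i x).
Proof.
move=> Hf; elim: r => [|i r IH].
  have := linear_span_sub _ F1.
  by congr linear_span; apply/funext => x; rewrite big_nil.
have := linear_span_mul _ _ (Hf i) IH.
by congr linear_span; apply/funext => x; rewrite big_cons.
Qed.

Lemma linear_span_exp f n : linear_span F f -> linear_span F (fun x => f x ^+ n).
Proof.
move=> Hf; have := linear_span_prod _ (index_enum 'I_n) _ (fun=> Hf).
by congr linear_span; apply/funext => x; rewrite prodr_const card_ord.
Qed.

End linear_span_algebra.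

(* [2 + y + 1/y = (1 + y)^2 / y], so the sum picks out the central binomial
   coefficient of [(1 + y)^(2N)] as soon as [N < M]. *)
Lemma central_binomial_sum (K : fieldType) (z w : K) (M N : nat) :
  z != 0 -> M.-primitive_root w -> (N < M)%N ->
  \sum_(j < M) (2 + z * w ^+ j + (z * w ^+ j)^-1) ^+ N = (M * 'C(N.*2, N))%:R.
Proof.
move=> z0 wM NM; have M0 := prim_order_gt0 wM.
have w0 : w != 0.
  by apply/eqP => w0; have := prim_expr_order wM;
    rewrite w0 expr0n gtn_eqF// => /eqP; rewrite eq_sym oner_eq0.
have e (j : 'I_M) : (2 + z * w ^+ j + (z * w ^+ j)^-1) ^+ N =
    \sum_(k < N.*2.+1) ('C(N.*2, k)%:R * z ^+ k / z ^+ N) * (w ^+ k / w ^+ N) ^+ j.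
  have y0 : z * w ^+ j != 0 by rewrite mulf_neq0// expf_neq0.
  have -> : 2 + z * w ^+ j + (z * w ^+ j)^-1 = (1 + z * w ^+ j) ^+ 2 / (z * w ^+ j).
    by move: y0; set y := z * _ => y0; field.
  rewrite expr_div_n -exprM mul2n exprDn mulr_suml; apply: eq_bigr => k _.
  rewrite expr1n mul1r -mulr_natl exprMn exprMn expr_div_n -!exprM.
  rewrite [(k * j)%N]mulnC [(N * j)%N]mulnC; field.
  by rewrite !expf_neq0.
rewrite (eq_bigr _ (fun j _ => e j)) exchange_big /=.
have NN : (N < N.*2.+1)%N by rewrite ltnS -addnn leq_addr.
rewrite (bigD1 (Ordinal NN))//= [X in _ + X]big1 ?addr0 => [|k kN].
  rewrite -mulr_sumr mulfK ?expf_neq0//.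
  under eq_bigr do rewrite divff ?expf_neq0// expr1n.
  by rewrite sumr_const card_ord -natrM mulnC.
rewrite -mulr_sumr; set a := w ^+ k / w ^+ N.
(* For [k != N], [a] is an [M]-th root of unity other than 1, because [|k - N| <= N < M]; hence its
   powers sum to zero. *)
suff -> : \sum_(j < M) a ^+ j = 0 by rewrite mulr0.
have aM : a ^+ M = 1.
  by rewrite expr_div_n -!exprM ![(_ * M)%N]mulnC !exprM (prim_expr_order wM) !expr1n
    divr1.
have a1 : a - 1 != 0.
  rewrite subr_eq0; apply: contra kN => /eqP ae.
  have : w ^+ k == w ^+ N by rewrite -[w ^+ k](divfK (expf_neq0 N w0)) -/a ae mul1r.
  rewrite (eq_prim_root_expr wM) => kNM; apply/eqP/val_inj => /=.
  have : (k <= N + N)%N by rewrite addnn -ltnS.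
  move: kNM.
  case: (leqP N k) => [Nk|kN].
    by rewrite eqn_mod_dvd// => /dvdn_leq; lia.
  by rewrite eq_sym eqn_mod_dvd ?(ltnW kN)// => /dvdn_leq; lia.
by apply: (mulfI a1); rewrite -subrX1 aM subrr mulr0.
Qed.

(** The sign matches the translates [t - j/M] in [raised_cos_sum]. *)
Lemma expi_primitive_root (R : realType) (M : nat) : (0 < M)%N ->
  M.-primitive_root (expi R (- M%:R^-1)).
Proof.
move=> M0; rewrite /primitive_root_of_unity M0 /=; apply/forallP => i; apply/eqP.
have M0R : M%:R != 0 :> R by rewrite pnatr_eq0 -lt0n.
rewrite unity_rootE -expiMn; apply/eqP/eqP => [/expi_eq1|->].
  move=> /intrP[m /(congr1 (fun t => - (t * M%:R)))] /=.
  rewrite -[_ *+ i.+1]mulr_natl mulrN mulNr opprK mulfVK// -mulNr => /eqP.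
  rewrite -mulrNz -[M%:R]/((M : int)%:~R) -[i.+1%:R]/((i.+1 : int)%:~R) -rmorphM
    eqr_int.
  move=> /eqP /(congr1 absz); rewrite abszM abszN /= => im.
  have /dvdn_leq : (M %| i.+1)%N by rewrite im dvdn_mull.
  by move=> /(_ isT) ?; apply/esym/eqP; rewrite eqn_leq ltn_ord andbT.
by rewrite mulNrn -[M%:R^-1 *+ M]mulr_natl divff// expiN -[1]/(1%:~R) expi_int invr1.
Qed.

(** Equals [|1 + exp(2 pi i t)|^2], with maximum 4 at the integers. Its powers are nonnegative
    kernels peaking there, and 4 minus it is [|exp(2 pi i t) - 1|^2]. *)
Definition raised_cos (R : realType) (t : R) : R := 2 + 2 * cos (t * pi *+ 2).

Lemma raised_cosE (R : realType) (t : R) :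
  (raised_cos R t)%:C = 2 + expi R t + (expi R t)^-1.
Proof.
rewrite -expi_conj /raised_cos -[RHS]addrA addcJ /= rmorphD rmorphM /=.
by rewrite -[X in _ = _ + X * _](rmorph_nat (real_complex R)) -[X in _ = X +
  _](rmorph_nat (real_complex R)).
Qed.

Lemma raised_cos_ge0 (R : realType) (t : R) : 0 <= raised_cos R t.
Proof. by have := cos_geN1 (t * pi *+ 2); rewrite /raised_cos; lra. Qed.

Lemma normc_expi_dist (R : realType) (s t : R) :
  normc (expi R s - expi R t) ^+ 2 = 4 - raised_cos R (s - t).
Proof.
have -> : expi R s - expi R t = expi R t * (expi R (s - t) - 1).
  by rewrite mulrBr -expiD mulr1 [t + _]addrC subrK.
rewrite ComplexField.Normc.normcM normc_expi mul1r /expi /raised_cos.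
set x := _ *+ 2; rewrite (_ : _ - 1 = (cos x - 1) +i* sin x); last by simpc.
rewrite /= sqr_sqrtr ?addr_ge0 ?sqr_ge0//.
have := cos2Dsin2 x; set a := cos x; set b := sin x => ab.
by rewrite (_ : _ + _ = a ^+ 2 + b ^+ 2 + 1 - 2 * a); [rewrite ab; ring|ring].
Qed.

(** The [N]-th power is a trigonometric polynomial of degree [N], so more than [N] equispaced nodes
    recover its mean exactly, whatever [t]. *)
Lemma raised_cos_sum (R : realType) (t : R) (M N : nat) : (N < M)%N ->
  \sum_(j < M) raised_cos R (t - j%:R / M%:R) ^+ N = (M * 'C(N.*2, N))%:R.
Proof.
move=> NM; have M0 : (0 < M)%N by exact: leq_trans NM.
apply: (@complexI R); rewrite rmorph_sum /= rmorph_nat.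
rewrite -(central_binomial_sum _ _ _ _ _ (expi_neq0 R t) (expi_primitive_root R M M0)
  NM).
apply: eq_bigr => j _; rewrite rmorphXn /= raised_cosE -expiMn -expiD.
by rewrite mulNrn mulr_natl.
Qed.

Lemma central_binS (N : nat) : (N.+1 * 'C(N.+1.*2, N.+1) = 2 * N.*2.+1 * 'C(N.*2, N))%N.
Proof.
have sym : 'C(N.*2.+1, N) = 'C(N.*2.+1, N.+1).
  by rewrite -bin_sub; [congr 'C(_, _)|]; rewrite -addnn; lia.
rewrite doubleS binS sym addnn -muln2 mulnA -mul_bin_diag /=; lia.
Qed.

(** Consecutive central binomial coefficients have ratio [2 (2N+1) / (N+1)], and 4 minus this is
    [2 / (N+1)]. Taking [N.+2] nodes makes the sums exact for both exponents [N] and [N.+1]. *)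
Lemma raised_cos_moment (R : realType) (t : R) (N : nat) :
  \sum_(j < N.+2) raised_cos R (t - j%:R / N.+2%:R) ^+ N / (N.+2 * 'C(N.*2, N))%:R
    * (4 - raised_cos R (t - j%:R / N.+2%:R)) = 2 / N.+1%:R.
Proof.
set D := (N.+2 * _)%:R.
have b0 : 'C(N.*2, N)%:R != 0 :> R by rewrite pnatr_eq0 -lt0n bin_gt0 -addnn leq_addr.
have N10 : N.+1%:R != 0 :> R by rewrite pnatr_eq0.
have N20 : N.+2%:R != 0 :> R by rewrite pnatr_eq0.
have e (j : 'I_N.+2) : raised_cos R (t - j%:R / N.+2%:R) ^+ N / D
    * (4 - raised_cos R (t - j%:R / N.+2%:R)) =
    (4 * raised_cos R (t - j%:R / N.+2%:R) ^+ N -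
     raised_cos R (t - j%:R / N.+2%:R) ^+ N.+1) / D.
  by rewrite exprS; ring.
rewrite (eq_bigr _ (fun j _ => e j)) -mulr_suml sumrB -mulr_sumr !raised_cos_sum//.
have := congr1 (fun k => k%:R : R) (central_binS N); rewrite /= !natrM => cb.
rewrite /D !natrM; apply: (mulIf N10); rewrite mulfVK//.
have key (a b c m : R) : a != 0 -> b != 0 ->
    (4 * (a * b) - a * c) / (a * b) * m = (4 * m * b - m * c) / b.
  by move=> a0 b0'; field; rewrite a0 b0'.
rewrite key// cb.
have -> : N.*2.+1%:R = 2 * N%:R + 1 :> R by rewrite -natr1 -muln2 natrM mulrC.
by rewrite -[N.+1%:R]natr1; field.
Qed.

(** Linearity of expectation under product weights: for each index [i0], the other factors sum to
    1. *)
Lemma product_weight_moment (R : realType) (n M : nat) (w d : 'I_n -> 'I_M ->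
  R) (e : R) :
  (forall i, \sum_j w i j = 1) -> (forall i, \sum_j w i j * d i j = e) ->
  \sum_(s : {ffun 'I_n -> 'I_M}) \prod_i w i (s i) * \sum_i d i (s i) = n%:R * e.
Proof.
move=> w1 wd; under eq_bigr do rewrite mulr_sumr.
rewrite exchange_big /= -[n in RHS]card_ord mulr_natl -sumr_const.
apply: eq_bigr => i0 _.
(* Absorbing [d i0] into the factor of index [i0] makes the summand a product again, so that sum and
   product can be exchanged. *)
rewrite (eq_bigr (fun s : {ffun 'I_n -> 'I_M} =>
    \prod_i (w i (s i) * (if i == i0 then d i0 (s i) else 1)))) => [|s _].
  rewrite -(bigA_distr_bigA (fun i j => w i j * (if i == i0 then d i0 j else 1))).
  rewrite (bigD1 i0)//= [X in _ * X]big1 ?mulr1 => [|i /negbTE ->].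
    by rewrite eqxx.
  by under eq_bigr do rewrite mulr1.
by rewrite big_split /= -big_mkcond big_pred1_eq.
Qed.

Lemma product_weight_sum (R : realType) (n M : nat) (w : 'I_n -> 'I_M -> R) :
  (forall i, \sum_j w i j = 1) ->
  \sum_(s : {ffun 'I_n -> 'I_M}) \prod_i w i (s i) = 1.
Proof. by move=> w1; rewrite -bigA_distr_bigA big1. Qed.

Section torus_density.
Variables (R : realType) (F : set (torus R -> (R[i] : numFieldType))).
Hypothesis F1 : F (fun=> 1).
Hypothesis FM : forall f g, F f -> F g -> F (fun x => f x * g x).
Hypothesis Fcoord : forall k, F (fun x => cexp R (x k)).
Hypothesis FcoordV : forall k, F (fun x => (cexp R (x k))^-1).

Lemma weight_linear_span (k N : nat) (a D : R) :
  linear_span F (fun x => (raised_cos R (repr (x k) - a) ^+ N / D)%:C).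
Proof.
have e : (fun x : torus R => (raised_cos R (repr (x k) - a) ^+ N / D)%:C : R[i]) =
    (fun x => D^-1%:C * (2 * 1 + expi R (- a) * cexp R (x k) + expi R a * (cexp R (x
      k))^-1) ^+ N).
  apply/funext => x; rewrite rmorphM /= rmorphXn /= raised_cosE mulrC mulr1.
  by rewrite -expiN opprB !expiD (expiN R (repr (x k))) [expi R (repr (x k)) * _]mulrC.
rewrite e; apply: linear_span_scale; apply: linear_span_exp => //.
apply: linear_span_add; last by apply: linear_span_scale; exact: linear_span_sub.
apply: linear_span_add; apply: linear_span_scale; exact: linear_span_sub.
Qed.

(* A discrete Korovkin argument: [h] averages [g] over a finite grid, with weights
   given by products of powers of the raised cosine, whose total mass and second
   moment are known exactly. *)
Lemma torus_approximation (g : torus R -> (R[i] : numFieldType)) (eta : R) :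
  continuous g -> 0 < eta ->
  exists2 h, linear_span F h & forall x, normc (g x - h x) < eta.
Proof.
move=> cg eta0; have eta20 : 0 < eta / 2 by rewrite divr_gt0.
have ccoord k : continuous (fun x : torus R => cexp R (x k)).
  move=> x; apply: continuous_comp; first exact: torus_proj_continuous.
  exact: cexp_continuous.
have sep (x y : torus R) : (forall k, cexp R (x k) = cexp R (y k)) -> x = y.
  by move=> h; apply/funext => k; apply: cexp_inj.
have [n Hn] := compact_separating_bound R (torus R) g (fun k x => cexp R (x k))
  (@torus_compact R) cg ccoord sep _ eta20.
(* The second moments of [n] coordinates add up to [n * 2/(N+1)]; this [N] makes [n] times that
   total smaller than [eta / 2]. *)
pose N := Num.truncn (4 * n%:R ^+ 2 / eta).
have HN : n%:R * (n%:R * (2 / N.+1%:R)) < eta / 2.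
  have : 4 * n%:R ^+ 2 / eta < N.+1%:R by exact: truncnS_gt.
  rewrite ltr_pdivrMr// => h.
  have N10 : 0 < N.+1%:R :> R by rewrite ltr0n.
  rewrite -(ltr_pM2r N10).
  rewrite (_ : _ * N.+1%:R = 2 * n%:R ^+ 2); last by field; rewrite gt_eqF.
  lra.
pose D : R := (N.+2 * 'C(N.*2, N))%:R.
have D0 : 0 < D by rewrite ltr0n muln_gt0 bin_gt0 -addnn leq_addr.
pose node (j : 'I_N.+2) : R := j%:R / N.+2%:R.
(* Coordinates of index at least [n] are set to 0, since the bound [Hn] sees only the first [n]. *)
pose pt (s : {ffun 'I_n -> 'I_N.+2}) : torus R := fun k =>
  if insub k is Some i then to_circle (node (s i)) else 0.
pose w (x : torus R) (i : 'I_n) (j : 'I_N.+2) : R :=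
  raised_cos R (repr (x i) - node j) ^+ N / D.
pose W x (s : {ffun 'I_n -> 'I_N.+2}) := \prod_i w x i (s i).
have w0 x i j : 0 <= w x i j by rewrite divr_ge0 ?exprn_ge0 ?raised_cos_ge0// ltW.
have w1 x i : \sum_j w x i j = 1.
  by rewrite -mulr_suml raised_cos_sum ?divff ?gt_eqF.
have W0 x s : 0 <= W x s by apply: prodr_ge0.
have W1 x : \sum_s W x s = 1 by apply: product_weight_sum.
exists (fun x => \sum_s g (pt s) * (W x s)%:C).
  apply: linear_span_sum => s; apply: linear_span_scale.
  have -> : (fun x => (W x s)%:C : R[i]) = (fun x => \prod_(i < n) (w x i (s i))%:C).
    by apply/funext => x; rewrite rmorph_prod.
  by apply: linear_span_prod => // i; exact: weight_linear_span.
move=> x; have gE : g x = \sum_s g x * (W x s)%:C.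
  by rewrite -mulr_sumr -rmorph_sum W1 mulr1.
rewrite {1}gE -sumrB.
under eq_bigr do rewrite -mulrBl.
have tri : normc (\sum_s (g x - g (pt s)) * (W x s)%:C) <= \sum_s W x s * normc (g x
  - g (pt s)).
  rewrite -lecR -normr_normc (le_trans (ler_norm_sum _ _ _))// rmorph_sum ler_sum//
    => s _.
  by rewrite normrM normr_normc mulrC rmorphM /= normr_normc /= expr0n /= addr0
    sqrtr_sqr ger0_norm.
apply: le_lt_trans tri _.
have dist s (i : 'I_n) : normc (cexp R (x i) - cexp R (pt s i)) ^+ 2 =
    4 - raised_cos R (repr (x i) - node (s i)).
  by rewrite /pt valK cexp_to_circle normc_expi_dist.
apply: (@le_lt_trans _ _ (\sum_s W x s * (eta / 2 + n%:R * \sum_(i < n) (4 -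
  raised_cos R (repr (x i) - node (s i)))))).
  apply: ler_sum => s _; rewrite ler_wpM2l//.
  apply: le_trans (Hn x (pt s)) _; rewrite lerD2l ler_wpM2l// ler_sum// => i _.
  by rewrite dist.
under eq_bigr do rewrite mulrDr [W _ _ * (n%:R * _)]mulrCA.
rewrite big_split /= -mulr_suml W1 mul1r -mulr_sumr.
rewrite (product_weight_moment R n N.+2 (w x) (fun i j => 4 - raised_cos R (repr (x
  i) - node j)) (2 / N.+1%:R))//.
  by rewrite [X in _ < X]splitr ltrD2l.
by move=> i; exact: raised_cos_moment.
Qed.

Lemma torus_linearly_dense : linearly_dense F.
Proof.
move=> g cg B /uniform_nbhs[E [entE EB]].
move: entE; rewrite -entourage_ballE => -[e /= e0 eE].
(* The radius [e] lives in [R[i]]; being positive, it is real. *)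
have /andP[/eqP eIm eRe] : (complex.Im e == 0) &&
  (0 < complex.Re e) by rewrite ltcE in e0.
have [h Fh gh] := torus_approximation g (complex.Re e) cg eRe.
exists h; split=> //; apply: EB => y _; apply: eE => /=.
by rewrite /ball /= normr_normc ltcE /= eIm eqxx gh.
Qed.

End torus_density.

(** * Rigidity sums *)

Lemma continuous_normc_measurable (R : realType) (X : ptopologicalType)
    (k : X -> (R[i] : numFieldType)) :
  continuous k -> measurable_fun setT (fun x : borel X => normc (k x)).
Proof.
move=> ck.
have cn : continuous (fun x => normc (k x)).
  move=> x; apply/cvgrPdist_lt => e e0.
  apply: filterS ((continuous_normcP R X k x).1 (ck x) e e0) => y.
  apply: le_lt_trans; have := normc_distD R (k y) (k x) 0.
  have := normc_distD R (k x) (k y) 0; rewrite !subr0 [normc (k y - _)]normc_distC.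
  by rewrite ler_norml => *; apply/andP; split; lra.
apply: (measurability _ (measurable_realfun.RGenOInfty.measurableE R)).
move=> _ [_ [a ->] <-]; rewrite setTI; apply: sub_sigma_algebra.
by apply: open_comp => [x _|]; [exact: cn|exact: interval_open].
Qed.

(** The constant [a^2] has integral [a^2] against a probability. *)
Lemma L2_norm_sq_le (R : realType) (X : ptopologicalType)
    (nu : probability (borel X) R) (k : X -> (R[i] : numFieldType)) (a : R) :
  continuous k -> (forall x, normc (k x) <= a) -> (L2_norm nu k ^+ 2 <= (a ^+ 2)%:E)%E.
Proof.
move=> ck ka; have a0 : 0 <= a by apply: le_trans (ka point); exact: normc_ge0.
rewrite EFin_expe !expe2.
suff le_a : (L2_norm nu k <= a%:E)%E by apply: lee_pmul => //; exact: Lnorm_ge0.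
rewrite /L2_norm unlock.
rewrite (_ : a%:E = (a ^+ 2)%:E `^ 2^-1)%E; last first.
  by rewrite poweR_EFin -powR_mulrn// -powRrM divff// powRr1.
apply: gt0_ler_poweR; rewrite ?invr_ge0 ?ler0n// ?in_itv /= ?leey ?andbT.
- by apply: integral_ge0 => x _; rewrite lee_fin powR_ge0.
- by rewrite lee_fin sqr_ge0.
have -> : (a ^+ 2)%:E = (\int[nu]_(x in setT) cst (a ^+ 2)%:E x)%E.
  rewrite integral_cst// -[LHS]mule1; congr (_ * _)%E.
  exact/esym/(probability_setT nu).
under eq_integral do rewrite ger0_norm ?normc_ge0// powR_mulrn ?normc_ge0//.
apply: ge0_le_integral => //.
- by move=> x _; rewrite lee_fin sqr_ge0.
- by apply/measurable_realfun.measurable_EFinP;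
  apply: measurable_realfun.measurable_funX; exact: continuous_normc_measurable.
by move=> x _; rewrite lee_fin ler_pXn2r ?nnegrE ?normc_ge0.
Qed.

Section iterates.
Variables (R : realType) (X : ptopologicalType) (T : homeo X).

Lemma iter_continuous (U : topologicalType) (g : U -> U) (n : nat) :
  continuous g -> continuous (iter n g).
Proof.
move=> cg; elim: n => [|n IH] x; first exact: cvg_id.
by apply: continuous_comp; [exact: IH|exact: cg].
Qed.

Lemma homeo_iter_continuous (m : int) : continuous (homeo_iter T m).
Proof.
case: m => n; apply: iter_continuous; first exact: homeo_fun_continuous.
exact: homeo_inv_continuous.
Qed.

Lemma homeo_iterN (n : nat) (x : X) : homeo_iter T (- n%:Z) x = iter n (homeo_inv T) x.
Proof. by case: n => [|n]. Qed.

Lemma iter_homeo_invK (n : nat) (x : X) : iter n T (iter n (homeo_inv T) x) = x.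
Proof.
elim: n x => [|n IH] x //; rewrite iterSr.
by rewrite [iter n.+1 _ x]iterS homeo_invK IH.
Qed.

(** Telescoping over [|j|] blocks of length [r]; a negative power is a positive one read from its
    end point. *)
Lemma homeo_iter_dist (f : X -> R[i]) (r : nat) (b : R) :
  (forall x, normc (f (iter r T x) - f x) <= b) ->
  forall (j : int) x, normc (f (homeo_iter T (j * r%:Z) x) - f x) <= `|j|%:~R * b.
Proof.
move=> fb.
have fwd (n : nat) x : normc (f (iter (n * r) T x) - f x) <= n%:R * b.
  elim: n => [|n IH]; first by rewrite mul0n subrr ComplexField.Normc.normc0 mul0r.
  rewrite mulSn iterD; apply: le_trans (normc_distD R (f (iter (n * r) T x)) _ _) _.
  by rewrite -natr1 mulrDl mul1r addrC lerD.
case=> n x; first by rewrite -PoszM; exact: fwd.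
rewrite NegzE mulNr -PoszM homeo_iterN normrN.
rewrite -[X in _ - f X](iter_homeo_invK (n.+1 * r) x) normc_distC; exact: fwd.
Qed.

(** At most [2 r^delta + 1] indices [j] occur, and each term accumulates at most [r^delta]
    displacements of size [b]. *)
Lemma rigidity_sum_le (nu : probability (borel X) R) (f : X -> (R[i] : numFieldType))
    (r : nat) (delta b : R) :
  continuous f -> (forall x, normc (f (iter r T x) - f x) <= b) ->
  (rigidity_sum T nu f delta r <=
   ((2 * r%:R `^ delta + 1) * (r%:R `^ delta * b) ^+ 2)%:E)%E.
Proof.
move=> cf fb; have b0 : 0 <= b by apply: le_trans (fb point); exact: normc_ge0.
pose L := Num.truncn (r%:R `^ delta : R).
have L0 : L%:R <= r%:R `^ delta :> R by rewrite truncn_le// powR_ge0.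
(* The list of integers from [-L] to [L] turns the sum over a set into a finite iterated sum. *)
pose s : seq int := [seq (i%:Z - L%:Z : int) | i <- iota 0 (2 * L).+1].
have us : uniq s by rewrite map_inj_uniq ?iota_uniq// => i j /addIr [].
have sE : [set j : int | `|j|%:~R <= r%:R `^ delta] = [set` s].
  apply/seteqP; split=> j /=.
    rewrite -[`|j|]/(`|j|%N%:Z) -truncn_ge_nat ?powR_ge0// -/L => jL.
    by apply/mapP; exists (absz (j + L%:Z)); [rewrite mem_iota|]; lia.
  move=> js; have /mapP[i iL ->] : j \in s := js.
  rewrite mem_iota in iL.
  by apply: le_trans L0; rewrite -[L%:R]/(L%:Z%:~R) ler_int; lia.
rewrite /rigidity_sum sE -fsbig_seq//.
apply: (@le_trans _ _ (\sum_(j <- s) ((r%:R `^ delta * b) ^+ 2)%:E)%E).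
  rewrite big_seq [X in (_ <= X)%E]big_seq; apply: lee_sum => j js.
  apply: L2_norm_sq_le => [x|x].
    apply: (@continuousB _ _ _ (f \o homeo_iter T (j * r)) f); last exact: cf.
    by apply: continuous_comp; [exact: homeo_iter_continuous|exact: cf].
  apply: le_trans (homeo_iter_dist f r b fb j x) _; rewrite ler_wpM2r//.
  by have : [set` s] j by []; rewrite -sE.
rewrite sumEFin lee_fin big_const_seq count_predT size_map size_iota iter_addr_0 -[_
  ^+ 2 *+ _]mulr_natl.
by rewrite ler_wpM2r ?sqr_ge0// -natr1 natrM lerD2r ler_pM2l.
Qed.

(** With [delta = gamma / 3] and [t = r^delta], the rigidity sum is at most
    [3 t (t C t^(-3))^2 = 3 C^2 r^(-gamma)]. *)
Lemma polynomial_rate (nu : probability (borel X) R) (f : X -> (R[i] : numFieldType))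
    (C gamma : R) : continuous f -> 0 < gamma ->
  (forall N : nat, exists2 r : nat, (N <= r)%N && (0 < r)%N &
    forall x, normc (f (iter r T x) - f x) <= C * (r%:R^-1) `^ gamma) ->
  exists delta : R, 0 < delta /\ exists r : nat -> nat,
    [/\ (forall n, (0 < r n)%N), increasing_seq r &
      rigidity_sum T nu f delta (r n) @[n --> \oo] --> 0%E].
Proof.
move=> cf g0 H; exists (gamma / 3); split; first by rewrite divr_gt0.
pose nx N := projT1 (cid2 (H N)).
have nxP N : [/\ (N <= nx N)%N, (0 < nx N)%N &
    forall x, normc (f (iter (nx N) T x) - f x) <= C * ((nx N)%:R^-1) `^ gamma].
  by rewrite /nx; case: cid2 => r /= /andP[].
(* Each term is requested beyond the previous one, so [r] is strictly increasing and [r n > n]. *)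
pose r n := iter n (fun m => nx m.+1) (nx 1%N).
have [rP r0] : (forall n, exists N, r n = nx N) /\ (forall n, (n < r n)%N).
  suff rP n : (exists N, r n = nx N) /\ (n < r n)%N.
    by split=> n; case: (rP n).
  elim: n => [|n [_ IH]]; first by split; [exists 1%N|case: (nxP 1%N)].
  split; first by exists (r n).+1.
  by have [h _ _] := nxP (r n).+1; apply: leq_ltn_trans IH _; apply: leq_trans h.
exists r; split.
- by move=> n; apply: leq_ltn_trans (r0 n).
- by apply/increasing_seqP => n; have [] := nxP (r n).+1.
have bound n : (0 <= rigidity_sum T nu f (gamma / 3) (r n) <=
    (3 * C ^+ 2 * (n.+1%:R^-1) `^ gamma)%:E)%E.
  apply/andP; split.
    by apply: fsume_ge0 => j _; apply: expe_ge0; exact: Lnorm_ge0.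
  have [N rN] := rP n; have [_ _ hf] := nxP N; rewrite -rN in hf.
  apply: le_trans (rigidity_sum_le nu f (r n) (gamma / 3) _ cf hf) _.
  have rn0 : 0 < (r n)%:R :> R by rewrite ltr0n (leq_ltn_trans _ (r0 n)).
  have rn1 : 1 <= (r n)%:R :> R by rewrite ler1n (leq_ltn_trans _ (r0 n)).
  set t := _ `^ (gamma / 3).
  have t1 : 1 <= t by rewrite -(powRr0 (r n)%:R) ler_powR// divr_ge0 ?ltW.
  have tg : t ^+ 3 = (r n)%:R `^ gamma.
    by rewrite -powR_mulrn ?powR_ge0// -powRrM mulfVK.
  have gV : (r n)%:R^-1 `^ gamma = (t ^+ 3)^-1.
    by rewrite tg -powRN -[(r n)%:R^-1]powR_inv1 ?ler0n// -powRrM mulN1r.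
  rewrite lee_fin gV.
  apply: (@le_trans _ _ (3 * t * (t * (C * (t ^+ 3)^-1)) ^+ 2)).
    by rewrite ler_wpM2r ?sqr_ge0//; lra.
  have -> : 3 * t * (t * (C * (t ^+ 3)^-1)) ^+ 2 = 3 * C ^+ 2 * (t ^+ 3)^-1.
    by field; rewrite gt_eqF//; lra.
  rewrite ler_wpM2l //; first by apply: mulr_ge0 => //; exact: sqr_ge0.
  rewrite -gV ge0_ler_powR ?nnegrE ?invr_ge0 ?(ltW g0)//.
  by rewrite lef_pV2 ?posrE// ler_nat.
apply: (squeeze_cvge (f := fun=> 0%E) (h :=
  fun n => (3 * C ^+ 2 * (n.+1%:R^-1) `^ gamma)%:E)).
- by near=> n; exact: bound.
- exact: cvg_cst.
apply: cvg_EFin; first by near=> n.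
rewrite -[X in _ --> X](mulr0 (3 * C ^+ 2)); apply: cvgMr.
apply/cvgrPdist_lt => e e0.
pose e' := e `^ gamma^-1; have e'0 : 0 < e' by exact: powR_gt0.
exists (Num.truncn e'^-1) => // n /= en.
rewrite sub0r normrN ger0_norm ?powR_ge0//.
have -> : e = e' `^ gamma by rewrite -powRrM mulVf ?gt_eqF// powRr1// ltW.
apply: gt0_ltr_powR; rewrite ?nnegrE ?invr_ge0 ?ltW//.
rewrite -[e']invrK ltf_pV2 ?posrE ?invr_gt0 ?ltr0n//.
by apply: lt_le_trans (truncnS_gt _) _; rewrite ler_nat.
Unshelve. all: by end_near. Qed.

End iterates.

(** * Characters of the skew product *)

(** The derivative and the Hölder constant are explicit witnesses, so that sums, opposites and
    translates are handled by exhibiting theirs. *)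
Definition smooth_cocycle (R : realType) (eps : R) (u : R -> R) : Prop :=
  exists (v : R -> R) (C : R),
    [/\ forall x : R, is_derive x 1 u (v x), forall t, u (t + 1) = u t &
        forall x y, `|v x - v y| <= C * `|x - y| `^ eps].

Section smooth_cocycle_theory.
Variables (R : realType) (eps : R).

Lemma smooth_cocycle_cst (a : R) : smooth_cocycle R eps (fun=> a).
Proof.
exists (fun=> 0), 0; split=> // [x|x y]; first exact: is_derive_cst.
by rewrite subrr normr0 mul0r.
Qed.

Lemma smooth_cocycleD (u u' : R -> R) : smooth_cocycle R eps u ->
  smooth_cocycle R eps u' ->
  smooth_cocycle R eps (fun t => u t + u' t).
Proof.
move=> [v [C [uv pu hv]]] [v' [C' [uv' pu' hv']]].
exists (fun t => v t + v' t), (C + C'); split=> [x|t|x y].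
- exact: is_deriveD.
- by rewrite pu pu'.
rewrite opprD addrACA mulrDl (le_trans (ler_normD _ _))// lerD//.
Qed.

Lemma smooth_cocycleN (u : R -> R) : smooth_cocycle R eps u ->
  smooth_cocycle R eps (fun t => - u t).
Proof.
move=> [v [C [uv pu hv]]]; exists (fun t => - v t), C; split=> [x|t|x y].
- exact: is_deriveN.
- by rewrite pu.
by rewrite -opprD normrN.
Qed.

Lemma smooth_cocycle_shift (u : R -> R) (c : R) : smooth_cocycle R eps u ->
  smooth_cocycle R eps (fun t => u (t + c)).
Proof.
move=> [v [C [uv pu hv]]]; exists (fun t => v (t + c)), C; split=> [x|t|x y].
- exact: is_derive_translate.
- by rewrite addrAC pu.
by apply: le_trans (hv _ _) _; rewrite opprD addrACA subrr addr0.
Qed.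

Lemma C1_holder_smooth_cocycle (u : R -> R) : C1_holder eps u ->
  (forall t, u (t + 1) = u t) ->
  smooth_cocycle R eps u.
Proof.
move=> [du _ [C hC]] pu; exists (derive1 u), C; split=> // x.
by rewrite derive1E; exact: derivableP.
Qed.

End smooth_cocycle_theory.

Section skew_rigidity.
Variables (R : realType) (alpha beta : R) (h : R -> R).
Hypothesis ira : irrational alpha.
Hypothesis ph : forall t : R, h (t + 1) = h t.
Hypothesis ch : continuous h.
Variable eps : R.
Hypothesis eps0 : 0 < eps.
Hypothesis eps1 : eps < 1.
Hypothesis sh : smooth_cocycle R eps h.

Let T := skew_homeo alpha beta ph ch.

(** Quantifying over all real lifts [t] of the base coordinate avoids any choice of representative
    when the factors are multiplied along an orbit. *)
Definition cocycle_character : set (torus R -> (R[i] : numFieldType)) :=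
  [set f : torus R -> (R[i] : numFieldType) | [/\ continuous f, (forall x,
    normc (f x) = 1) &
    exists2 u : R -> R, smooth_cocycle R eps u &
      forall (x : torus R) (t : R), x 0%N = to_circle t ->
        f (T x) = f x * expi R (u t)]].

(** The base coordinate moves by the rotation, so the successive factors multiply to the exponential
    of a Birkhoff sum. *)
Lemma cocycle_character_iter (f : torus R -> R[i]) (u : R -> R) :
  (forall (x : torus R) (t : R), x 0%N = to_circle t -> f (T x) = f x * expi R (u t)) ->
  forall (n : nat) (x : torus R) (t : R), x 0%N = to_circle t ->
    f (iter n T x) = f x * expi R (birkhoff R alpha u n t).
Proof.
move=> fu n x t xt.
have base m : (iter m T x) 0%N = to_circle (t + m%:R * alpha).
  elim: m => [|m IH]; first by rewrite mul0r addr0.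
  by rewrite iterS /= IH -to_circleD -natr1 mulrDl mul1r addrA.
elim: n => [|n IH]; first by rewrite /birkhoff big_ord0 expi0 mulr1.
rewrite iterS (fu _ _ (base n)) IH -mulrA -expiD.
by rewrite /birkhoff big_ord_recr.
Qed.

(** As [f] is unimodular, the displacement of [f] after [r] steps has modulus
    [|exp(2 pi i S_r u) - 1|], which is small when [S_r u] is near an integer. *)
Lemma cocycle_character_rate (nu : probability (borel (torus R)) R)
    (f : torus R -> (R[i] : numFieldType)) :
  cocycle_character f -> exists delta : R, 0 < delta /\ exists r : nat -> nat,
    [/\ (forall n, (0 < r n)%N), increasing_seq r &
      rigidity_sum T nu f delta (r n) @[n --> \oo] --> 0%E].
Proof.
move=> [cf f1 [u [v [C [uv pu hv]]] fu]].
have [C' C'0 HC'] := birkhoff_near_int R alpha eps C u v ira eps0 eps1 uv pu hv.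
apply: (polynomial_rate _ _ _ nu f (4 * pi * C') (eps / 16)) => //.
  by rewrite divr_gt0.
move=> N; have [r Nr near] := HC' N; exists r => // x.
have xt : x 0%N = to_circle (repr (x 0%N)) by rewrite to_circle_repr.
rewrite (cocycle_character_iter f u fu r x _ xt) -[X in _ - X]mulr1 -mulrBr.
rewrite ComplexField.Normc.normcM f1 mul1r -mulrA.
by have [l hl] := near (repr (x 0%N)); exact: expi_dist1_int hl.
Qed.

Lemma cocycle_character1 : cocycle_character (fun=> 1).
Proof.
split=> [|x|]; [exact: cst_continuous|exact: ComplexField.Normc.normc1|].
exists (fun=> 0); first exact: smooth_cocycle_cst.
by move=> x t _; rewrite expi0 mulr1.
Qed.

Lemma cocycle_characterM f g : cocycle_character f -> cocycle_character g ->
  cocycle_character (fun x => f x * g x).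
Proof.
move=> [cf f1 [u su fu]] [cg g1 [u' su' gu']]; split.
- by move=> x; apply: continuousM; [exact: cf|exact: cg].
- by move=> x; rewrite ComplexField.Normc.normcM f1 g1 mulr1.
exists (fun t => u t + u' t); first exact: smooth_cocycleD.
by move=> x t xt; rewrite (fu _ _ xt) (gu' _ _ xt) expiD mulrACA.
Qed.

Lemma cocycle_characterV f : cocycle_character f ->
  cocycle_character (fun x => (f x)^-1).
Proof.
move=> [cf f1 [u su fu]]; split.
- move=> x; apply: continuousV; last exact: cf.
  by apply/eqP => fx0; have := f1 x; rewrite fx0 ComplexField.Normc.normc0 => /eqP;
    rewrite eq_sym oner_eq0.
- by move=> x; rewrite ComplexField.Normc.normcV f1 invr1.
exists (fun t => - u t); first exact: smooth_cocycleN.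
by move=> x t xt; rewrite (fu _ _ xt) expiN invfM.
Qed.

(** The base coordinate has the constant [alpha] as its [u]; coordinate [k.+1] has the translate of
    [h] by [k beta]. *)
Lemma cocycle_character_coord k : cocycle_character (fun x => cexp R (x k)).
Proof.
split.
- move=> x; apply: continuous_comp; first exact: torus_proj_continuous.
  exact: cexp_continuous.
- by move=> x; exact: normc_expi.
case: k => [|k].
  exists (fun=> alpha); first exact: smooth_cocycle_cst.
  by move=> x t _; rewrite /= cexpD cexp_to_circle.
exists (fun t => h (t + k%:R * beta)); first exact: smooth_cocycle_shift.
by move=> x t xt; rewrite /= cexpD xt cocycle_to_circle// cexp_to_circle.
Qed.

End skew_rigidity.

Theorem theorem3p1 (R : realType) (alpha beta : R)
    (halpha : irrational alpha) (hbeta : irrational beta)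
    (h : R -> R) (h_periodic : forall t : R, h (t + 1) = h t)
    (eps : R) (eps_gt0 : 0 < eps) (eps_lt1 : eps < 1)
    (h_smooth : C1_holder eps h)
    (nu : probability (borel (torus R)) R) :
  let T := skew_homeo alpha beta h_periodic (C1_holder_continuous h_smooth) in
  invariant_probability T nu -> polynomial_rigidity T nu.
Proof.
move=> T _; have sh := C1_holder_smooth_cocycle R eps h h_smooth h_periodic.
exists (cocycle_character R alpha beta h h_periodic (C1_holder_continuous h_smooth)
  eps); split.
- by move=> f [].
- apply: torus_linearly_dense.
  + exact: cocycle_character1.
  + exact: cocycle_characterM.
  + exact: cocycle_character_coord.
  + by move=> k; apply: cocycle_characterV; exact: cocycle_character_coord.
by move=> f Ff; apply: cocycle_character_rate Ff.
Qed.
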